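(* Let $V=\bigoplus_{m=0}^{\infty}V_m$ be a vertex operator algebra. Then the following are equivalent. (1) $V$ is $C_2$-cofinite. (2) Every weak $V$-module is a direct sum of generalized eigenspaces of $L(0)$. (3) Every weak $V$-module is an $\mathbb N$-graded weak module $W=\bigoplus_{n=0}^{\infty}W(n)$ such that each $W(n)$ is a direct sum of generalized eigenspaces of $L(0)$. (4) $V$ is finitely generated and every weak $V$-module is an $\mathbb N$-graded weak module.
   Context: $V=\bigoplus_{m\ge 0}V_m$ is a vertex operator algebra over $\mathbb C$ (no negative weights, each $V_m$ finite dimensional), $Y(v,z)=\sum_n v(n)z^{-n-1}$, $C_2(V)=\langle a(-2)b\mid a,b\in V\rangle$ (linear span), and $V$ is $C_2$-cofinite if $\dim V/C_2(V)<\infty$. A weak $V$-module is a vector space $M$ with module vertex operators $Y^M(v,z)=\sum_n v^M(n)z^{-n-1}\in\mathrm{End}(M)[[z,z^{-1}]]$ satisfying lower truncation ($v^M(n)w=0$ for $n\gg 0$), $Y^M(\mathbf 1,z)=1$, the Virasoro relations for $Y^M(\omega,z)=\sum_n L(n)z^{-n-2}$ and the $L(-1)$-derivative property, and the commutator and associativity formulas; no grading is assumed. An $\mathbb N$-graded weak module is a weak module admitting a grading $M=\bigoplus_{n=0}^\infty M(n)$ such that $v^M(m)M(n)\subseteq M(n+r-m-1)$ for $v\in V_r$. The generalized eigenspace of $L(0)$ for $\lambda\in\mathbb C$ is $\{w\mid (L(0)-\lambda)^Nw=0 \text{ for } N\gg 0\}$. *)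

(* Defs.v *)
From HB Require Import structures.
From mathcomp Require Import all_boot all_order all_algebra.
From mathcomp Require Import boolp classical_sets functions cardinality fsbigop.
From mathcomp Require Import reals complex.

Set Implicit Arguments.
Unset Strict Implicit.
Unset Printing Implicit Defensive.

Import Order.TTheory GRing.Theory Num.Theory.
Local Open Scope classical_set_scope.
Local Open Scope ring_scope.

Section LinearAlgebra.
Variables (K : fieldType) (M : lmodType K).

Definition subspace (U : set M) : Prop :=
  U 0 /\ forall (a : K) (u v : M), U u -> U v -> U (a *: u + v).

Definition linear_span (A : set M) : set M := smallest subspace A.

Definition finite_dim (U : set M) : Prop :=
  exists s : seq M, U = linear_span [set` s].

(* dim M/U < oo: the classes modulo U of finitely many vectors span M/U. *)
Definition finite_codim (U : set M) : Prop :=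
  exists s : seq M, forall w : M,
    exists2 u : M, linear_span [set` s] u & U (w - u).

(* W is the internal direct sum of the family U. *)
Definition direct_sum (I : choiceType) (U : I -> set M) (W : set M) : Prop :=
  [/\ subspace W,
      forall i, subspace (U i),
      forall i, U i `<=` W &
      forall w, W w -> exists! f : I -> M,
        [/\ finite_set [set i | f i != 0],
            forall i, U i (f i) &
            w = \sum_(i \in [set: I]) f i]].

Definition gen_eigenspace (f : M -> M) (a : K) : set M :=
  [set w | exists N0 : nat, forall N : nat, (N0 <= N)%N ->
             iter N (fun u => f u - a *: u) w = 0].

(* A family graded by nat, extended by 0 in negative degrees. *)
Definition int_grade (G : nat -> set M) (k : int) : set M :=
  if k is Posz n then G n else [set 0].

End LinearAlgebra.

Definition binomz (K : fieldType) (n : int) (i : nat) : K :=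
  (\prod_(j < i) (n - j%:Z)%:~R) / i`!%:R.

(* Y u n v is the n-th product u(n)v in V, and act v n is v^M(n) : M -> M; the
   operators L(n) are omega(n+1).  The sums over all i : nat have finite support
   thanks to wm_truncation (a \sum_(_ \in _) with infinite support would be 0). *)
Record weak_module_axioms (K : fieldType) (V : lmodType K)
    (Y : V -> int -> {linear V -> V}) (vac omega : V) (c : K)
    (M : lmodType K) (act : V -> int -> {linear M -> M}) : Prop := {
  wm_linear : forall (a : K) (u v : V) (n : int) (w : M),
    act (a *: u + v) n w = a *: act u n w + act v n w;
  wm_truncation : forall (v : V) (w : M),
    exists N : int, forall n : int, N <= n -> act v n w = 0;
  wm_vacuum : forall (n : int) (w : M),
    act vac n w = if n == -1 then w else 0;
  wm_Virasoro : forall (m n : int) (w : M),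
    act omega (m + 1) (act omega (n + 1) w)
      - act omega (n + 1) (act omega (m + 1) w)
    = (m - n)%:~R *: act omega (m + n + 1) w
      + (if m + n == 0 then ((m ^+ 3 - m)%:~R / 12%:R * c) *: w else 0);
  wm_derivative : forall (v : V) (n : int) (w : M),
    act (Y omega 0 v) n w = - (n%:~R *: act v (n - 1) w);
  wm_commutator : forall (u v : V) (m n : int) (w : M),
    act v n (act u m w) - act u m (act v n w)
    = \sum_(i \in [set: nat])
        binomz K n i *: act (Y v i%:Z u) (n + m - i%:Z) w;
  wm_associativity : forall (u v : V) (m n : int) (w : M),
    act (Y v n u) m w
    = \sum_(i \in [set: nat])
        ((-1) ^+ i * binomz K n i) *:
          (act v (n - i%:Z) (act u (m + i%:Z) w)
           - ((-1) ^ n : K) *: act u (n + m - i%:Z) (act v i%:Z w))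
}.

(* Commutator and associativity formulas together are the Jacobi identity, so
   V is required to be a weak module over itself through Y. *)
Record voa (K : fieldType) := VOA {
  voa_space :> lmodType K;
  voa_Y : voa_space -> int -> {linear voa_space -> voa_space};
  voa_vac : voa_space;
  voa_omega : voa_space;
  voa_charge : K;
  voa_grade : nat -> set voa_space;
  voa_adjoint :
    weak_module_axioms voa_Y voa_vac voa_omega voa_charge voa_Y;
  voa_creation : forall (v : voa_space) (n : int),
    -1 <= n -> voa_Y v n voa_vac = if n == -1 then v else 0;
  voa_direct_sum : direct_sum voa_grade setT;
  voa_finite_dim : forall m : nat, finite_dim (voa_grade m);
  voa_L0 : forall (m : nat) (v : voa_space),
    voa_grade m v -> voa_Y voa_omega 1 v = m%:R *: v;
  voa_vac_grade : voa_grade 0%N voa_vac;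
  voa_omega_grade : voa_grade 2%N voa_omega
}.

Record weak_module (K : fieldType) (V : voa K) := WeakModule {
  wm_space :> lmodType K;
  wm_act : V -> int -> {linear wm_space -> wm_space};
  wm_axioms : weak_module_axioms (@voa_Y K V) (voa_vac V) (voa_omega V)
                (voa_charge V) wm_act
}.

Section Conditions.
Variables (K : fieldType) (V : voa K).

Definition C2 : set V :=
  linear_span [set x | exists a b : V, x = voa_Y a (-2) b].

Definition C2_cofinite : Prop := finite_codim C2.

Definition vertex_subalgebra (U : set V) : Prop :=
  [/\ subspace U, U (voa_vac V) &
      forall (u v : V) (n : int), U u -> U v -> U (voa_Y u n v)].

Definition finitely_generated : Prop :=
  exists s : seq V, smallest vertex_subalgebra [set` s] = setT.

Variable M : weak_module V.

Definition L_op (n : int) : M -> M := wm_act M (voa_omega V) (n + 1).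

Definition N_grading (G : nat -> set M) : Prop :=
  direct_sum G setT /\
  forall (r n : nat) (m : int) (v : V) (w : M), voa_grade r v -> G n w ->
    int_grade G (n%:Z + r%:Z - m - 1) (wm_act M v m w).

End Conditions.

Arguments L_op {K V} M n w.
Arguments N_grading {K V} M G.

(* Main.v *)
Require Import Defs.
From HB Require Import structures.
From mathcomp Require Import all_boot all_order all_algebra.
From mathcomp Require Import boolp classical_sets functions cardinality fsbigop.
From mathcomp Require Import reals complex ring zify.

(** Everything is compared with C2-cofiniteness.

    From weak modules to C2-cofiniteness.  Let Z = V / C2(V).  The space of linear
    maps V -> Z carries the contragredient action: v(m) acts by composition with the
    opposite mode of v, the coefficient of z^(-m-1) in
    Y(exp(z L(1)) (- z^(-2))^(L(0)) v, z^(-1)).  Opposite modes satisfy the Borcherds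
    identity with products reversed (opmode_borcherds), because inverting the two
    variables turns it into a combination of Borcherds identities in V; so the maps f
    that are truncated, i.e. killed by the modes v(m) with m large, form a weak module
    (dual_module).  The projection f : V -> Z is truncated, since C2(V) contains all
    values a(-n)b with n >= 2.

    If this module is N-graded, f has components in degrees below some R only.  For v
    of weight r >= R the mode v(2r - 1) lowers degrees by r and kills f; evaluated at
    the vacuum this says that v lies in C2(V) (C2_cofinite_of_N_graded).  If the module
    is a sum of generalized eigenspaces of L(0), then p(L(0)) f = 0 for a nonzero
    polynomial p; as L(0) acts by composition with L(0), p(n) f vanishes on V_n, and
    V_n lies in C2(V) for n large (C2_cofinite_of_eigen).  In both cases V / C2(V) is
    finite-dimensional.

    From C2-cofiniteness to weak modules.  Modulo vectors a(-2)c, finitely many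
    homogeneous vectors B span V.  For w in a weak module, every product of modes
    applied to w is a combination of products of the same degree in which the vectors
    belong to B, the modes increase strictly from left to right, and the last one is
    bounded by a constant depending on w (words_normal_span): letters commute modulo
    smaller weight, and a pair u(n) v(n) is rewritten by means of (u(-1)v)(2n+1).
    Strictly increasing bounded modes leave finitely many products of each degree and
    none of very negative degree.  The powers of L(0) have degree 0, so some nonzero
    p(L(0)) kills w (L0_annihilated), and w is a sum of generalized eigenvectors.

    For the grading, the eigenvalues in each class of K / Z must be bounded below.
    Otherwise there are lowest weight vectors x_k whose eigenvalues form an infinite
    set; the family of all x_k is truncated in a product of copies of the module,
    hence is killed by one p(L(0)), and p has infinitely many roots
    (eigenvalues_bounded).  The degree of a generalized eigenvector is then the height
    of its eigenvalue above the lowest one in its class.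

    Finally, the vectors B generate V, by induction on the weight. *)

Set Implicit Arguments.
Unset Strict Implicit.
Unset Printing Implicit Defensive.

Import Order.TTheory GRing.Theory Num.Theory.
Local Open Scope classical_set_scope.
Local Open Scope ring_scope.

(** * Sums over the natural numbers and binomial coefficients *)

Section FiniteSupport.
Variables (M : zmodType) (I : choiceType).
Implicit Type f : I -> M.

Lemma fsum_seq (s : seq I) f : uniq s -> (forall i, i \notin s -> f i = 0) ->
  \sum_(i \in [set: I]) f i = \sum_(i <- s) f i.
Proof.
move=> us fs; rewrite [RHS](fsbig_seq _ _ us); apply/esym/fsbig_widen => //.
by move=> i [_ /= /negP] /fs.
Qed.

Lemma finite_set_enum (A : set I) :
  finite_set A -> exists2 s : seq I, uniq s & forall i, A i <-> i \in s.
Proof.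
move=> /finite_seqP[s sA]; exists (undup s); first exact: undup_uniq.
by move=> i; rewrite mem_undup sA.
Qed.

Lemma fsum1 f k : (forall i, i != k -> f i = 0) ->
  \sum_(i \in [set: I]) f i = f k.
Proof.
move=> fk; rewrite (@fsum_seq [:: k]) ?big_seq1 // => i.
by rewrite inE => /fk.
Qed.

End FiniteSupport.

Section Nat.
Variable M : zmodType.

Lemma fsum_ord N (F : nat -> M) : (forall i, (N <= i)%N -> F i = 0) ->
  \sum_(i \in [set: nat]) F i = \sum_(i < N) F i.
Proof.
move=> FN; rewrite (@fsum_seq _ _ (iota 0 N)) ?iota_uniq //.
  by rewrite -(big_mkord xpredT) /index_iota subn0.
by move=> i; rewrite mem_iota add0n /= -leqNgt; apply: FN.
Qed.

Lemma sum_ord_widen N N' (F : nat -> M) : (N <= N')%N ->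
  (forall i, (N <= i)%N -> F i = 0) -> \sum_(i < N') F i = \sum_(i < N) F i.
Proof.
move=> NN' FN; rewrite -(fsum_ord FN) (@fsum_ord N') // => i iN'.
by apply: FN; apply: leq_trans iN'.
Qed.

(** The pairs (k, e) are grouped by d = k + e, as in a Cauchy product. *)
Lemma sum_antidiagonal N (G : nat -> nat -> M) :
  (forall k e, (N <= k)%N || (N <= e)%N -> G k e = 0) ->
  \sum_(d < N + N) \sum_(k < d.+1) G k (d - k)%N
  = \sum_(k < N) \sum_(e < N) G k e.
Proof.
move=> G0.
transitivity (\sum_(d < N + N) \sum_(k < N + N | (k <= d)%N) G k (d - k)%N).
  apply: eq_bigr => d _.
  rewrite (big_ord_widen_cond (N + N) xpredT (fun k => G k (d - k)%N)) //=.
rewrite (exchange_big_dep xpredT) //=.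
rewrite (@sum_ord_widen N (N + N)
  (fun k => \sum_(d < N + N | (k <= d)%N) G k (d - k)%N)) ?leq_addr //; last first.
  by move=> k Nk; rewrite big1 // => d _; rewrite G0 // Nk.
apply: eq_bigr => k _.
rewrite -(big_mkord (fun d => (k <= d)%N) (fun d => G k (d - k)%N)).
rewrite (big_cat_nat (n := k)) //=; last first.
  by apply: leq_trans (leq_addr N N); apply: ltnW.
rewrite big_nat_cond big1 ?add0r; last first.
  by move=> i; rewrite andbC => /and3P[ki _ ik]; move: (leq_ltn_trans ki ik); rewrite ltnn.
rewrite -{1}[k : nat]add0n big_addn big_nat_cond.
rewrite (eq_bigl (fun i => 0 <= i < N + N - k)%N); last first.
  by move=> i; rewrite leq_addl andbT.
rewrite -big_nat (eq_bigr (fun e => G k e)); last by move=> i _; rewrite addnK.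
rewrite big_mkord (@sum_ord_widen N) //; last by move=> i Ni; rewrite G0 // Ni orbT.
by rewrite -addnBA ?leq_addr // ltnW.
Qed.

End Nat.

Section Binomials.
Variable K : numFieldType.
Local Notation C := (@binomz K).

Lemma binomz0 n : C n 0 = 1.
Proof. by rewrite /binomz big_ord0 fact0 divr1. Qed.

Lemma binomz_recr n i : i.+1%:R * C n i.+1 = (n - i%:Z)%:~R * C n i.
Proof.
have f0 (k : nat) : k`!%:R != 0 :> K by rewrite pnatr_eq0 -lt0n fact_gt0.
rewrite /binomz big_ord_recr /= factS natrM.
have i0 : i.+1%:R != 0 :> K by rewrite pnatr_eq0.
by field; rewrite f0 addrC natr1 i0.
Qed.

Lemma binomz0S i : C 0 i.+1 = 0.
Proof. by rewrite /binomz big_ord_recl subrr mul0r mul0r. Qed.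

Lemma binomzS n i : C (n + 1) i.+1 = C n i.+1 + C n i.
Proof.
elim: i => [|i IH].
  have := binomz_recr (n + 1) 0; have := binomz_recr n 0.
  by rewrite !binomz0 !mul1r !mulr1 !subr0 => -> ->; rewrite intrD.
have i0 : i.+2%:R != 0 :> K by rewrite pnatr_eq0.
apply: (mulfI i0); rewrite mulrDr !binomz_recr {}IH.
have := binomz_recr n i.
rewrite !intrD !mulrNz -!pmulrn -!natr1.
move: (C n i.+1) (C n i) => a b H.
by transitivity ((n%:~R - i%:R) * a + (n%:~R - i%:R) * b); [ring | rewrite -H; ring].
Qed.

Lemma binomz_nat_gt (n i : nat) : (n < i)%N -> C n i = 0.
Proof.
by move=> ni; rewrite /binomz (bigD1 (Ordinal ni)) //= subrr mul0r mul0r.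
Qed.

Lemma binomz1 n : C n 1 = n%:~R.
Proof.
by have := binomz_recr n 0; rewrite mul1r binomz0 mulr1 subr0.
Qed.

(** Vandermonde, for upper arguments that may be negative.  Pascal's rule in p
    turns the sum for (p + 1, N, l) into the one for (p, N, l) minus the one
    for (p, N - 1, l - 1), which is also how the right-hand side behaves. *)
Lemma binomz_Vandermonde l : forall (p N : int),
  \sum_(i < l.+1) (-1) ^+ i * C p i * C (N - i%:Z) (l - i) = C (N - p) l.
Proof.
elim: l => [|l IH] p N.
  by rewrite big_ord1 !binomz0 expr0 !mulr1.
pose F p N := \sum_(i < l.+2) (-1) ^+ i * C p i * C (N - i%:Z) (l.+1 - i).
have FS q : F (q + 1) N = F q N - C (N - 1 - q) l.
  rewrite -IH /F [LHS]big_ord_recl [in X in _ = X - _]big_ord_recl.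
  rewrite !binomz0 -addrA; congr (_ + _).
  rewrite -sumrB; apply: eq_bigr => i _.
  rewrite !lift0 binomzS subSS.
  have -> : N - i.+1%:Z = N - 1 - i%:Z by rewrite -[i.+1]addn1 PoszD opprD addrA addrAC.
  by rewrite exprS; ring.
have CS q : C (N - (q + 1)) l.+1 = C (N - q) l.+1 - C (N - 1 - q) l.
  have := binomzS (N - 1 - q) l.
  have -> : N - 1 - q + 1 = N - q by ring.
  have -> : N - 1 - q = N - (q + 1) by ring.
  by move=> ->; rewrite addrK.
rewrite -/(F p N).
elim/int_rec: p => [|n IHn|n IHn].
- rewrite /F big_ord_recl binomz0 expr0 !mul1r !subr0 big1 ?addr0 // => i _.
  by rewrite lift0 binomz0S mulr0 mul0r.
- by rewrite -[n.+1]addn1 PoszD FS CS IHn.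
- have E : - (n%:Z) = - n.+1%:Z + 1 by rewrite -[n.+1]addn1 PoszD opprD addrNK.
  by have := FS (- n.+1%:Z); have := CS (- n.+1%:Z); rewrite -E IHn => -> /addIr ->.
Qed.

End Binomials.

(** * Subspaces, direct sums and generalized eigenspaces *)

Section Subspaces.
Variables (K : fieldType) (M : lmodType K).
Implicit Types (U : set M) (A : set M).

Lemma subspaceZ U a u : subspace U -> U u -> U (a *: u).
Proof. by move=> [U0 UD] Uu; rewrite -[_ *: _]addr0; apply: UD. Qed.

Lemma subspaceD U u v : subspace U -> U u -> U v -> U (u + v).
Proof. by move=> [U0 UD] Uu Uv; rewrite -[u]scale1r; apply: UD. Qed.

Lemma subspaceB U u v : subspace U -> U u -> U v -> U (u - v).
Proof. by move=> [U0 UD] Uu Uv; rewrite addrC -scaleN1r; apply: UD. Qed.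

Lemma subspace_sum U (I : Type) (r : seq I) (P : pred I) (F : I -> M) :
  subspace U -> (forall i, P i -> U (F i)) -> U (\sum_(i <- r | P i) F i).
Proof.
by move=> sU UF; apply: big_ind => //; [case: sU | move=> *; apply: subspaceD].
Qed.

Lemma subspace_sum_seq U (I : eqType) (r : seq I) (F : I -> M) :
  subspace U -> (forall i, i \in r -> U (F i)) -> U (\sum_(i <- r) F i).
Proof. by move=> sU UF; rewrite big_seq; apply: subspace_sum. Qed.

Lemma subspace_fsum U (F : nat -> M) :
  subspace U -> (forall i, U (F i)) -> U (\sum_(i \in [set: nat]) F i).
Proof. by move=> sU UF; apply: subspace_sum. Qed.

Lemma subspaceI U U' : subspace U -> subspace U' -> subspace (U `&` U').
Proof.
by move=> [? UD] [? UD']; split=> // a u v [? ?] [? ?]; split; [apply: UD|apply: UD'].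
Qed.

Lemma subspaceT : subspace [set: M].
Proof. by split. Qed.

Lemma linear_span_subspace A : subspace (linear_span A).
Proof.
split=> [B [[B0 _] _]//|a u v Au Av B [sB AB]].
by case: (sB) => _; apply; [apply: Au|apply: Av].
Qed.

Lemma sub_linear_span A : A `<=` linear_span A.
Proof. by move=> u Au B [_]; apply. Qed.

Lemma linear_span_min A U : subspace U -> A `<=` U -> linear_span A `<=` U.
Proof. by move=> sU AU u; apply. Qed.

Lemma linear_span_mono A B : A `<=` B -> linear_span A `<=` linear_span B.
Proof.
move=> AB; apply: linear_span_min; first exact: linear_span_subspace.
by move=> x /AB; apply: sub_linear_span.
Qed.

Lemma linear_span_seqP (s : seq M) w :
  linear_span [set` s] w ->
  exists c : 'I_(size s) -> K, w = \sum_(i < size s) c i *: s`_i.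
Proof.
move: w; apply: linear_span_min.
  split; first by exists (fun=> 0); rewrite big1 // => i _; rewrite scale0r.
  move=> a u v [c ->] [d ->]; exists (fun i => a * c i + d i).
  by rewrite scaler_sumr -big_split; apply: eq_bigr => i _; rewrite scalerDl scalerA.
move=> x /= xs; have ix : (index x s < size s)%N by rewrite index_mem.
exists (fun i => (i == Ordinal ix)%:R); rewrite (bigD1 (Ordinal ix)) //= eqxx.
by rewrite scale1r nth_index // big1 ?addr0 // => i /negPf ->; rewrite scale0r.
Qed.

Lemma linear_fsum (N : lmodType K) (f : {linear M -> N}) (F : nat -> M) n :
  (forall i, (n <= i)%N -> F i = 0) ->
  f (\sum_(i \in [set: nat]) F i) = \sum_(i \in [set: nat]) f (F i).
Proof.
move=> Fn; rewrite (fsum_ord Fn) (@fsum_ord _ n) ?linear_sum //.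
by move=> i /Fn ->; rewrite linear0.
Qed.

End Subspaces.

Section DirectSums.
Variables (K : fieldType) (M : lmodType K) (I : choiceType).

(** Decompositions are given as lists of pairs in which an index may repeat, so that
    they can be built one summand at a time; equal indices are collected here. *)
Lemma direct_sum_intro (U : I -> set M) (W : set M) :
  subspace W -> (forall i, subspace (U i)) -> (forall i, U i `<=` W) ->
  (forall w, W w -> exists2 s : seq (I * M),
     forall x, x \in s -> U x.1 x.2 & w = \sum_(x <- s) x.2) ->
  (forall (s : seq I) f, uniq s -> (forall i, U i (f i)) ->
     \sum_(i <- s) f i = 0 -> forall i, i \in s -> f i = 0) ->
  direct_sum U W.
Proof.
move=> sW sU UW ex un; split=> // w Ww.
have [s Us wE] := ex w Ww.
pose g i := \sum_(x <- s | x.1 == i) x.2; pose r0 := undup (map fst s).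
have Ug i : U i (g i).
  rewrite /g big_seq_cond; apply: subspace_sum => // x /andP[xs /eqP <-].
  exact: Us.
have gs i : i \notin r0 -> g i = 0.
  rewrite mem_undup => is_; rewrite /g big_seq_cond big1 // => x /andP[xs /eqP xi].
  by rewrite -xi map_f in is_.
have wg : w = \sum_(i \in [set: I]) g i.
  rewrite (fsum_seq (undup_uniq _) gs) wE /g (exchange_big_dep xpredT) //=.
  rewrite [LHS]big_seq [RHS]big_seq; apply: eq_bigr => x xs.
  rewrite big_mkcond (bigD1_seq x.1) ?undup_uniq ?mem_undup ?map_f //= eqxx.
  by rewrite big1 ?addr0 // => j /negPf; rewrite eq_sym => ->.
exists g; split.
  split=> //.
  apply: (@sub_finite_set _ _ [set` r0]); last first.
    by apply/finite_seqP; exists r0.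
  by move=> i /=; apply: contraR => /gs ->.
move=> h [/finite_set_enum[t ut ht] Uh wh]; apply/funext => i.
pose r := undup (i :: r0 ++ t).
have ur : uniq r by exact: undup_uniq.
have hr j : j \notin r -> h j = 0.
  rewrite mem_undup inE mem_cat !negb_or => /and3P[_ _ jt].
  by apply/eqP; apply: contraNT jt => hj; apply/ht.
have gr j : j \notin r -> g j = 0.
  rewrite mem_undup inE mem_cat !negb_or => /and3P[_ js _].
  exact: gs.
apply/eqP; rewrite -subr_eq0; apply/eqP.
apply: (un r (fun i => g i - h i)) => //.
- by move=> j; apply: subspaceB.
- by rewrite sumrB -(fsum_seq ur hr) -(fsum_seq ur gr) -wg -wh subrr.
- by rewrite mem_undup inE eqxx.
Qed.

Variable U : I -> set M.
Hypothesis dU : direct_sum U setT.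

Lemma component_exists (w : M) : exists f : I -> M,
  [/\ finite_set [set i | f i != 0], forall i, U i (f i) &
      w = \sum_(i \in [set: I]) f i].
Proof. by case: dU => _ _ _ /(_ w Logic.I)[f [fP _]]; exists f. Qed.

Definition component (w : M) : I -> M := projT1 (cid (component_exists w)).

Lemma component_in w i : U i (component w i).
Proof. by rewrite /component; case: cid => f []. Qed.

Lemma component_supp w : exists2 s : seq I, uniq s &
  forall i, i \notin s -> component w i = 0.
Proof.
rewrite /component; case: cid => f [/finite_set_enum[s us sP] _ _] /=.
exists s => // i is_; apply/eqP; apply: contraNT is_ => fi; exact/sP.
Qed.

Lemma component_sum w : w = \sum_(i \in [set: I]) component w i.
Proof. by rewrite {1 2}/component; case: cid => f []. Qed.

Lemma component_unique w (s : seq I) f : uniq s -> (forall i, U i (f i)) ->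
  (forall i, i \notin s -> f i = 0) -> w = \sum_(i <- s) f i ->
  component w = f.
Proof.
move=> us Uf fs wE; case: (dU) => _ _ _ /(_ w Logic.I)[g [_ gU]].
have <- : g = component w.
  by apply: gU; rewrite /component; case: cid.
apply: gU; split=> //; last by rewrite (fsum_seq us fs).
apply: (@sub_finite_set _ _ [set` s]); last by apply/finite_seqP; exists s.
by move=> i /=; apply: contraR => /fs ->.
Qed.

Lemma componentP a u v i :
  component (a *: u + v) i = a *: component u i + component v i.
Proof.
have [s us cs] := component_supp u; have [t ut ct] := component_supp v.
have sU j : subspace (U j) by case: dU.
pose r := undup (s ++ t).
have cr j : j \notin r -> component u j = 0 /\ component v j = 0.
  by rewrite mem_undup mem_cat negb_or => /andP[/cs ? /ct ?].
rewrite (@component_unique _ r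
  (fun j => a *: component u j + component v j)) ?undup_uniq //.
- by move=> j; case: (sU j) => _; apply; apply: component_in.
- by move=> j /cr[-> ->]; rewrite scaler0 addr0.
rewrite big_split /= -scaler_sumr {1}(component_sum u) {1}(component_sum v).
by congr (_ *: _ + _); apply: fsum_seq; rewrite ?undup_uniq // => j /cr[].
Qed.

Lemma component_id k x i : U k x -> component x i = if i == k then x else 0.
Proof.
move=> Ux; have U0 j : U j 0 by case: dU => _ /(_ j)[].
rewrite (@component_unique x [:: k] (fun j => if j == k then x else 0)) //.
- by move=> j; case: eqP => [->|].
- by move=> j; rewrite inE => /negPf ->.
by rewrite big_seq1 eqxx.
Qed.

Lemma component0 i : component 0 i = 0.
Proof.
rewrite (@component_unique 0 [::] (fun=> 0)) ?big_nil // => j.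
by case: dU => _ /(_ j)[].
Qed.

Lemma component_mem (P : set M) w : subspace P ->
  (forall i, P (component w i)) -> P w.
Proof.
move=> sP Pc; have [s us cs] := component_supp w.
by rewrite (component_sum w) (fsum_seq us cs); apply: subspace_sum.
Qed.

End DirectSums.

Section PolynomialAction.
Variables (K : fieldType) (M : lmodType K) (f : {linear M -> M}).
Implicit Types p q : {poly K}.

Definition poly_act p w := \sum_(i < size p) p`_i *: iter i f w.

Lemma poly_actE p n w : (size p <= n)%N ->
  poly_act p w = \sum_(i < n) p`_i *: iter i f w.
Proof.
move=> pn; rewrite (@sum_ord_widen _ (size p) n (fun i => p`_i *: iter i f w)) //.
by move=> i pi; rewrite nth_default // scale0r.
Qed.

Lemma iter_linear n a u v : iter n f (a *: u + v) = a *: iter n f u + iter n f v.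
Proof. by elim: n => //= n ->; rewrite linearP. Qed.

Lemma poly_actP p a u v : poly_act p (a *: u + v) = a *: poly_act p u + poly_act p v.
Proof.
rewrite /poly_act scaler_sumr -big_split; apply: eq_bigr => i _.
by rewrite iter_linear scalerDr !scalerA mulrC.
Qed.

HB.instance Definition _ p :=
  GRing.isLinear.Build K M M _ (poly_act p) (fun a u v => poly_actP p a u v).

Lemma poly_actD p q w : poly_act (p + q) w = poly_act p w + poly_act q w.
Proof.
pose n := maxn (size p) (size q).
rewrite (@poly_actE (p + q) n) ?size_polyD // (@poly_actE p n) ?leq_maxl //.
rewrite (@poly_actE q n) ?leq_maxr // -big_split; apply: eq_bigr => i _.
by rewrite coefD scalerDl.
Qed.

Lemma poly_actC c w : poly_act c%:P w = c *: w.
Proof.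
rewrite (@poly_actE _ 1) ?big_ord1 ?coefC //.
by rewrite size_polyC; case: (c != 0).
Qed.

Lemma poly_actZ c p w : poly_act (c *: p) w = c *: poly_act p w.
Proof.
rewrite (@poly_actE _ (size p)) ?size_scale_leq // scaler_sumr.
by apply: eq_bigr => i _; rewrite coefZ scalerA.
Qed.

Lemma poly_actMX p w : poly_act (p * 'X) w = f (poly_act p w).
Proof.
rewrite (@poly_actE _ (size p).+1).
  rewrite big_ord_recl coefMX eqxx scale0r add0r linear_sum.
  by apply: eq_bigr => i _; rewrite lift0 coefMX /= linearZ.
by apply: leq_trans (size_polyMleq _ _) _; rewrite size_polyX addn2.
Qed.

Lemma poly_actM p q w : poly_act (p * q) w = poly_act p (poly_act q w).
Proof.
elim/poly_ind: p => [|p c IH].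
  by rewrite mul0r -polyC0 !poly_actC !scale0r.
by rewrite mulrDl mulrAC !poly_actD !poly_actMX IH mul_polyC poly_actC poly_actZ.
Qed.

Lemma poly_act_XsubC a w : poly_act ('X - a%:P) w = f w - a *: w.
Proof.
by rewrite -[X in X - _]mul1r -polyCN poly_actD poly_actMX !poly_actC scale1r scaleNr.
Qed.

Lemma iter_sub_eigen a n w :
  iter n (fun u => f u - a *: u) w = poly_act (('X - a%:P) ^+ n) w.
Proof.
elim: n => [|n IH] /=; first by rewrite expr0 poly_actC scale1r.
by rewrite exprS poly_actM poly_act_XsubC IH.
Qed.

Lemma gen_eigenspaceP a w :
  gen_eigenspace f a w <-> exists n, poly_act (('X - a%:P) ^+ n) w = 0.
Proof.
split=> [[n nP]|[n nP]]; first by exists n; rewrite -iter_sub_eigen; apply: nP.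
by exists n => m nm; rewrite iter_sub_eigen -(subnK nm) exprD poly_actM nP linear0.
Qed.

Lemma gen_eigenspace_subspace a : subspace (gen_eigenspace f a).
Proof.
split; first by apply/gen_eigenspaceP; exists 0; rewrite linear0.
move=> c u v /gen_eigenspaceP[n un] /gen_eigenspaceP[m vm].
apply/gen_eigenspaceP; exists (n + m).
by rewrite poly_actP exprD [in X in _ + X]poly_actM vm mulrC poly_actM un !linear0 addr0.
Qed.

(** Bezout's identity u p + v q = 1, applied to w. *)
Lemma coprimep_act p q w : coprimep p q ->
  poly_act p w = 0 -> poly_act q w = 0 -> w = 0.
Proof.
move=> /Bezout_eq1_coprimepP[[u v] /= uv] pw qw.
have : poly_act 1 w = 0.
  by rewrite -uv poly_actD !poly_actM pw qw !linear0 addr0.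
by rewrite -polyC1 poly_actC scale1r.
Qed.

Lemma gen_eigenspace_root a p w : p != 0 ->
  gen_eigenspace f a w -> poly_act p w = 0 -> w != 0 -> root p a.
Proof.
move=> p0 /gen_eigenspaceP[n wn] pw; apply: contraR => pa; apply/eqP.
apply: coprimep_act wn pw; rewrite coprimep_sym coprimep_expr //.
by rewrite coprimep_XsubC.
Qed.

Definition annihilator (s : seq K) (n : K -> nat) : {poly K} :=
  \prod_(a <- s) ('X - a%:P) ^+ n a.

Lemma annihilator_neq0 s n : annihilator s n != 0.
Proof.
rewrite prodf_seq_neq0; apply/allP => a _ /=.
by rewrite expf_neq0 // polyXsubC_eq0.
Qed.

Lemma annihilator_act s n (g : K -> M) :
  (forall a, poly_act (('X - a%:P) ^+ n a) (g a) = 0) ->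
  poly_act (annihilator s n) (\sum_(a <- s) g a) = 0.
Proof.
move=> gn; rewrite linear_sum big_seq big1 // => a sa.
rewrite /annihilator (perm_big _ (perm_to_rem sa)) big_cons /= mulrC poly_actM gn.
exact: linear0.
Qed.

Lemma gen_eigenspaces_annihilated s (g : K -> M) :
  (forall a, gen_eigenspace f a (g a)) ->
  exists2 p, p != 0 & poly_act p (\sum_(a <- s) g a) = 0.
Proof.
move=> ge; have /choice[n nP] a : exists n, poly_act (('X - a%:P) ^+ n) (g a) = 0.
  by have [N NP] := ge a; exists N; rewrite -iter_sub_eigen; apply: NP.
by exists (annihilator s n); [apply: annihilator_neq0 | apply: annihilator_act].
Qed.

(** The product of the powers of 'X - b that kill the other summands also kills
    g a, and it is coprime to the power of 'X - a that does. *)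
Lemma gen_eigenspaces_free (s : seq K) (g : K -> M) : uniq s ->
  (forall a, gen_eigenspace f a (g a)) -> \sum_(a <- s) g a = 0 ->
  forall a, a \in s -> g a = 0.
Proof.
move=> us ge gs a sa; have /choice[n nP] b : exists n,
    poly_act (('X - b%:P) ^+ n) (g b) = 0.
  by have [N NP] := ge b; exists N; rewrite -iter_sub_eigen; apply: NP.
apply: (@coprimep_act (annihilator (rem a s) n) (('X - a%:P) ^+ n a)) => //.
  apply: coprimep_expr; rewrite coprimep_XsubC /root horner_prod prodf_seq_neq0.
  apply/allP => b; rewrite mem_rem_uniq // inE => /andP[ba _] /=.
  by rewrite horner_exp hornerXsubC expf_neq0 // subr_eq0 eq_sym.
have -> : g a = - \sum_(b <- rem a s) g b.
  apply/eqP; move: gs; rewrite (perm_big _ (perm_to_rem sa)) big_cons /= => /eqP.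
  by rewrite addr_eq0.
by rewrite [LHS]linearN /= annihilator_act ?oppr0.
Qed.

(** There are more iterates of w than vectors in t: a nonzero row vector in the
    kernel of their coordinate matrix gives the coefficients of p. *)
Lemma finite_orbit_annihilated (t : seq M) w :
  (forall n, linear_span [set` t] (iter n f w)) ->
  exists2 p, p != 0 & poly_act p w = 0.
Proof.
move=> span; have /choice[c cP] n := linear_span_seqP (span n).
pose m := size t; pose A := \matrix_(i < m.+1, j < m) c i j.
have : kermx A != 0 by rewrite -mxrank_eq0 mxrank_ker -lt0n subn_gt0 ltnS rank_leq_col.
move=> /rowV0Pn[v /sub_kermxP vA v0]; exists (\poly_(i < m.+1) v 0 (inord i)).
  apply: contraNneq v0 => p0; apply/eqP/rowP => i; rewrite mxE.
  have := congr1 (fun p : {poly K} => p`_i) p0.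
  by rewrite coef_poly ltn_ord inord_val coef0.
rewrite (poly_actE _ (size_poly _ _)).
transitivity (\sum_(i < m.+1) \sum_(j < m) (v 0 i * A i j) *: t`_j).
  apply: eq_bigr => i _; rewrite coef_poly ltn_ord inord_val cP scaler_sumr.
  by apply: eq_bigr => j _; rewrite mxE scalerA.
rewrite exchange_big /=; apply: big1 => j _; rewrite -scaler_suml.
by have := congr1 (fun B : 'rV_m => B 0 j) vA; rewrite !mxE => ->; rewrite scale0r.
Qed.

End PolynomialAction.

Section ClosedField.
Variables (K : closedFieldType) (M : lmodType K) (f : {linear M -> M}).

(** Bezout's identity splits off the factor of p at one root at a time. *)
Lemma annihilated_decomposition (p : {poly K}) w : p != 0 -> poly_act f p w = 0 ->
  exists2 s : seq (K * M), forall x, x \in s -> gen_eigenspace f x.1 x.2 &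
    w = \sum_(x <- s) x.2.
Proof.
have [n] := ubnP (size p); elim: n p w => // n IH p w; rewrite ltnS => pn p0 pw.
have [/eqP/size_poly1P[c c0 pc]|p1] := eqVneq (size p) 1%N.
  exists [::] => //; rewrite big_nil; apply/eqP; move: pw; rewrite pc poly_actC => /eqP.
  by rewrite scaler_eq0 (negPf c0).
have /closed_rootP[a pa] := p1.
have [k [q qa pE]] := multiplicity_XsubC p a.
have {}qa : ~~ root q a by rewrite p0 in qa.
have q0 : q != 0 by apply: contraNneq qa => ->; rewrite root0.
have k0 : (0 < k)%N.
  by case: k pE => // pE; rewrite pE expr0 mulr1 (negPf qa) in pa.
have cop : coprimep (('X - a%:P) ^+ k) q.
  by rewrite coprimep_pexpl // coprimep_sym coprimep_XsubC.
have /Bezout_eq1_coprimepP[[u v] /= uv] := cop.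
pose w1 := poly_act f (v * q) w; pose w2 := poly_act f (u * ('X - a%:P) ^+ k) w.
have w12 : w = w1 + w2.
  by rewrite addrC -poly_actD uv -polyC1 poly_actC scale1r.
have [||s ge w2E] := IH q w2 _ q0.
- apply: leq_trans pn; rewrite pE size_Mmonic ?monic_exp ?monicXsubC //.
  by rewrite size_exp_XsubC addnS -[X in (X < _)%N]addn0 ltn_add2l.
- by rewrite -poly_actM mulrCA -pE poly_actM pw linear0.
exists ((a, w1) :: s); last by rewrite big_cons -w2E.
move=> x; rewrite inE => /predU1P[->|/ge //] /=.
apply/gen_eigenspaceP; exists k.
by rewrite -poly_actM mulrCA [_ * q]mulrC -pE poly_actM pw linear0.
Qed.

End ClosedField.

(** * The Borcherds identity *)

Section FsumNat.
Variables (K : numFieldType) (M : lmodType K).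
Implicit Types F G : nat -> M.

Definition eventually0 F := exists n, forall i, (n <= i)%N -> F i = 0.

Lemma eventually0D F G :
  eventually0 F -> eventually0 G -> eventually0 (fun i => F i + G i).
Proof.
move=> [n Fn] [m Gm]; exists (maxn n m) => i; rewrite geq_max => /andP[/Fn -> /Gm ->].
exact: addr0.
Qed.

Lemma eventually0Z (c : nat -> K) F :
  eventually0 F -> eventually0 (fun i => c i *: F i).
Proof. by move=> [n Fn]; exists n => i /Fn ->; rewrite scaler0. Qed.

Lemma eventually0S F : eventually0 F -> eventually0 (fun i => F i.+1).
Proof. by move=> [n Fn]; exists n => i ni; rewrite Fn // leqW. Qed.

Lemma fsumD F G : eventually0 F -> eventually0 G ->
  \sum_(i \in [set: nat]) (F i + G i)
  = \sum_(i \in [set: nat]) F i + \sum_(i \in [set: nat]) G i.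
Proof.
move=> [n Fn] [m Gm]; pose k := maxn n m.
have Fk i : (k <= i)%N -> F i = 0 by rewrite geq_max => /andP[/Fn].
have Gk i : (k <= i)%N -> G i = 0 by rewrite geq_max => /andP[_ /Gm].
rewrite (fsum_ord Fk) (fsum_ord Gk) (@fsum_ord _ k) ?big_split // => i ki.
by rewrite Fk // Gk // addr0.
Qed.

Lemma fsumZ c F : eventually0 F ->
  \sum_(i \in [set: nat]) c *: F i = c *: \sum_(i \in [set: nat]) F i.
Proof.
move=> [n Fn]; rewrite (fsum_ord Fn) scaler_sumr (@fsum_ord _ n) // => i /Fn ->.
exact: scaler0.
Qed.

(** Pascal's rule as a summation by parts. *)
Lemma fsum_Pascal (e : K) q (X : nat -> M) : eventually0 X ->
  \sum_(i \in [set: nat]) (e ^+ i * binomz K (q + 1) i) *: X i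
  = \sum_(i \in [set: nat]) (e ^+ i * binomz K q i) *: (X i + e *: X i.+1).
Proof.
move=> [n Xn].
rewrite (@fsum_ord _ n.+1); last by move=> i ni; rewrite Xn ?scaler0 // ltnW.
rewrite (@fsum_ord _ n); last first.
  by move=> i ni; rewrite !Xn ?leqW // scaler0 addr0 scaler0.
under [RHS]eq_bigr do rewrite scalerDr scalerA.
rewrite big_split /= big_ord_recl !binomz0.
rewrite -[X in _ = X + _](@sum_ord_widen _ n n.+1
  (fun i => (e ^+ i * binomz K q i) *: X i)) //; last first.
  by move=> i ni; rewrite Xn // scaler0.
rewrite [in RHS]big_ord_recl binomz0 -addrA; congr (_ + _).
rewrite -big_split /=; apply: eq_bigr => i _.
rewrite /bump /= add1n binomzS -scalerDl exprSr; congr (_ *: _); ring.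
Qed.

End FsumNat.

Lemma eventually0_sum (K : numFieldType) (M : lmodType K) n (F : 'I_n -> nat -> M) :
  (forall k, eventually0 (F k)) -> eventually0 (fun i => \sum_(k < n) F k i).
Proof.
elim: n F => [|n IH] F F0; first by exists 0%N => i _; rewrite big_ord0.
under [X in eventually0 X]funext do rewrite big_ord_recr.
by apply: eventually0D => //; apply: IH.
Qed.

Lemma fsum_sum (K : numFieldType) (M : lmodType K) n (F : 'I_n -> nat -> M) :
  (forall k, eventually0 (F k)) ->
  \sum_(i \in [set: nat]) \sum_(k < n) F k i = \sum_(k < n) \sum_(i \in [set: nat]) F k i.
Proof.
elim: n F => [|n IH] F F0.
  by rewrite big_ord0 fsbig1 // => i _; rewrite big_ord0.
under eq_fsbigr do rewrite big_ord_recr.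
by rewrite big_ord_recr /= fsumD ?IH //; apply: eventually0_sum.
Qed.

Lemma fsum_fun (K : numFieldType) (T : Type) (Z : lmodType K) (F : nat -> T -> Z) x :
  eventually0 F -> (\sum_(i \in [set: nat]) F i) x = \sum_(i \in [set: nat]) F i x.
Proof.
move=> [n Fn]; rewrite (fsum_ord Fn) (@fsum_ord _ n) ?fct_sumE //.
by move=> i /Fn ->.
Qed.

Section WeakModules.
Variables (K : numFieldType) (V : voa K).
Local Notation Y := (@voa_Y K V).
Local Notation om := (voa_omega V).

Section Borcherds.
Variables (M : lmodType K) (act : V -> int -> {linear M -> M}).
Hypothesis ax : weak_module_axioms Y (voa_vac V) om (voa_charge V) act.

Lemma wm_left_linear n w : linear (fun v : V => act v n w).
Proof. by move=> a u v; apply: (wm_linear ax). Qed.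

Definition act_left n w : V -> M := fun v => act v n w.
HB.instance Definition _ n w :=
  GRing.isLinear.Build K V M _ (act_left n w) (wm_left_linear n w).

Lemma wm_act0 n w : act 0 n w = 0.
Proof. exact: (linear0 (act_left n w)). Qed.

Lemma wm_actZ a v n w : act (a *: v) n w = a *: act v n w.
Proof. exact: (linearZZ (act_left n w)). Qed.

Lemma wm_act_sum (I : Type) (s : seq I) (P : pred I) (F : I -> V) n w :
  act (\sum_(i <- s | P i) F i) n w = \sum_(i <- s | P i) act (F i) n w.
Proof. exact: (linear_sum (act_left n w)). Qed.

Lemma wm_truncation_nat v n w :
  exists N : nat, forall i : nat, (N <= i)%N -> act v (n + i%:Z) w = 0.
Proof.
have [N NP] := wm_truncation ax v w.
by exists `|N - n|%N => i Ni; apply: NP; lia.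
Qed.

Variables (u v : V) (w : M).

Definition borcherds_l (p q r : int) := \sum_(i \in [set: nat])
  binomz K p i *: act (Y u (q + i%:Z) v) (p + r - i%:Z) w.

Definition borcherds_r (p q r : int) := \sum_(i \in [set: nat])
  ((-1) ^+ i * binomz K q i) *: (act u (p + q - i%:Z) (act v (r + i%:Z) w)
     - ((-1) ^ q : K) *: act v (q + r - i%:Z) (act u (p + i%:Z) w)).

Lemma borcherds_l_supp (m : int -> int) (q : int) :
  eventually0 (fun i : nat => act (Y u (q + i%:Z) v) (m i) w).
Proof.
have [N NP] := wm_truncation (voa_adjoint V) u v.
by exists `|N - q|%N => i Ni; rewrite NP ?wm_act0 //; lia.
Qed.

Lemma borcherds_r_supp (x y : V) (m : int -> int) (r : int) :
  eventually0 (fun i : nat => act x (m i) (act y (r + i%:Z) w)).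
Proof. by have [N NP] := wm_truncation_nat y r w; exists N => i /NP ->; rewrite linear0. Qed.

(** Both sides are linear in a test function in two variables x and y, namely
    x^p y^r (x - y)^q; the recurrence is x = (x - y) + y. *)
Lemma borcherds_l_rec p q r :
  borcherds_l (p + 1) q r = borcherds_l p q (r + 1) + borcherds_l p (q + 1) r.
Proof.
rewrite /borcherds_l.
have := fsum_Pascal 1 p (borcherds_l_supp (fun i => p + 1 + r - i) q).
under eq_fsbigr do rewrite expr1n mul1r.
under [in RHS]eq_fsbigr do rewrite expr1n mul1r scale1r scalerDr.
move=> ->; rewrite fsumD; first congr (_ + _).
- by apply: eq_fsbigr => i _; congr (_ *: act _ _ _); ring.
- apply: eq_fsbigr => i _; congr (_ *: act (Y _ _ _) _ _);
  by rewrite -addn1 PoszD; ring.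
- exact: (eventually0Z _ (borcherds_l_supp (fun i => p + 1 + r - i) q)).
- by apply: eventually0Z; apply: (eventually0S (borcherds_l_supp (fun i => p + 1 + r - i) q)).
Qed.

Lemma borcherds_r_rec p q r :
  borcherds_r (p + 1) q r = borcherds_r p q (r + 1) + borcherds_r p (q + 1) r.
Proof.
pose F p q r (i : nat) := act u (p + q - i%:Z) (act v (r + i%:Z) w)
     - ((-1) ^ q : K) *: act v (q + r - i%:Z) (act u (p + i%:Z) w).
have supp p' q' r' : eventually0 (F p' q' r').
  rewrite /F; under [X in eventually0 X]funext do rewrite -scaleNr.
  apply: eventually0D; first exact: (borcherds_r_supp u v (fun i => p' + q' - i)).
  apply: eventually0Z; exact: (borcherds_r_supp v u (fun i => q' + r' - i)).
have FE i : F (p + 1) q r i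
    = F p q (r + 1) i + (F p (q + 1) r i + (-1) *: F p (q + 1) r i.+1).
  rewrite /F -addn1 PoszD exprzDr ?unitrN1 // expr1z mulrN1.
  have -> : p + (q + 1) - i%:Z = p + 1 + q - i%:Z by ring.
  have -> : q + 1 + r - i%:Z = q + (r + 1) - i%:Z by ring.
  have -> : p + (q + 1) - (i%:Z + 1) = p + q - i%:Z by ring.
  have -> : q + 1 + r - (i%:Z + 1) = q + r - i%:Z by ring.
  have -> : p + (i%:Z + 1) = p + 1 + i%:Z by ring.
  have -> : r + (i%:Z + 1) = r + 1 + i%:Z by ring.
  rewrite !scaleNr !opprK scale1r.
  move: (act u _ _) (act u _ _) (_ *: _) (_ *: _) => a b c d.
  by rewrite opprD addrCA [X in _ = _ + X]addrACA subrr add0r addrA addrK.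
pose c i : K := (-1) ^+ i * binomz K q i.
transitivity (\sum_(i \in [set: nat]) (c i *: F p q (r + 1) i
    + c i *: (F p (q + 1) r i + (-1) *: F p (q + 1) r i.+1))).
  by apply: eq_fsbigr => i _; rewrite -scalerDr -FE.
rewrite fsumD; [|exact: (eventually0Z _ (supp _ _ _))|].
  by congr (_ + _); exact/esym/(fsum_Pascal (-1) q (supp p (q + 1) r)).
apply: eventually0Z; apply: eventually0D (supp _ _ _) _.
by apply: (eventually0Z (fun=> -1)); apply: (eventually0S (supp _ _ _)).
Qed.

Definition borcherds_at p q r := borcherds_l p q r = borcherds_r p q r.

Lemma borcherds_p0 q r : borcherds_at 0 q r.
Proof.
rewrite /borcherds_at /borcherds_l (@fsum1 _ _ _ 0%N); last first.
  by case=> // i _; rewrite binomz0S scale0r.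
rewrite binomz0 scale1r addr0 add0r subr0 (wm_associativity ax).
by apply: eq_fsbigr => i _; rewrite !add0r (addrC q r).
Qed.

Lemma borcherds_q0 p r : borcherds_at p 0 r.
Proof.
rewrite /borcherds_at /borcherds_r (@fsum1 _ _ _ 0%N); last first.
  by case=> // i _; rewrite binomz0S mulr0 scale0r.
rewrite binomz0 expr0 mulr1 expr0z !scale1r !addr0 !add0r ?subr0.
rewrite (wm_commutator ax).
by apply: eq_fsbigr => i _; rewrite add0r.
Qed.

(** The Borcherds identity.  Associativity is the case p = 0 and the commutator
    formula the case q = 0; the recurrence spreads it to all p >= 0, to all
    q >= 0, and then to the remaining quadrant. *)
Lemma borcherds p q r : borcherds_l p q r = borcherds_r p q r.
Proof.
have step p' q' r' : borcherds_at p' q' (r' + 1) -> borcherds_at p' (q' + 1) r' ->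
    borcherds_at (p' + 1) q' r'.
  by rewrite /borcherds_at borcherds_l_rec borcherds_r_rec => -> ->.
have stepq p' q' r' : borcherds_at (p' + 1) q' r' -> borcherds_at p' q' (r' + 1) ->
    borcherds_at p' (q' + 1) r'.
  by rewrite /borcherds_at borcherds_l_rec borcherds_r_rec => + E; rewrite E; apply: addrI.
have stepr p' q' r' : borcherds_at (p' + 1) q' r' -> borcherds_at p' (q' + 1) r' ->
    borcherds_at p' q' (r' + 1).
  by rewrite /borcherds_at borcherds_l_rec borcherds_r_rec => + E; rewrite E; apply: addIr.
have SE (n : nat) : n.+1%:Z = n%:Z + 1 by rewrite -addn1 PoszD.
have NE (n : nat) : - n.+1%:Z + 1 = - n%:Z by rewrite SE opprD addrNK.
have ppos (n : nat) q' r' : borcherds_at n q' r'.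
  elim: n q' r' => [|n IH] q' r'; first exact: borcherds_p0.
  by rewrite SE; apply: step; apply: IH.
have qpos (n : nat) p' r' : borcherds_at p' n r'.
  elim: n p' r' => [|n IH] p' r'; first exact: borcherds_q0.
  by rewrite SE; apply: stepq; apply: IH.
have neg (a b : nat) r' : borcherds_at (- a%:Z) (- b%:Z) r'.
  elim: a b r' => [|a IHa] b r'; first by rewrite oppr0; apply: borcherds_p0.
  elim: b r' => [|b IHb] r'; first by rewrite oppr0; apply: borcherds_q0.
  by rewrite -(subrK 1 r'); apply: stepr; rewrite NE; [apply: IHa|apply: IHb].
case: p => [n|n]; first exact: ppos.
by case: q => [m|m]; [apply: qpos | rewrite !NegzE; apply: neg].
Qed.

End Borcherds.

End WeakModules.

(** * Weights *)

Section Grading.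
Variables (K : numFieldType) (V : voa K).
Local Notation Y := (@voa_Y K V).
Local Notation om := (voa_omega V).
Local Notation grade := (@voa_grade K V).

(** Weights are integers, so that r + s - n - 1 is always one, as in homogeneous_Y;
    only 0 has negative weight. *)
Definition homogeneous (r : int) : set V := [set v | Y om 1 v = r%:~R *: v].

Lemma homogeneous_subspace r : subspace (homogeneous r).
Proof.
split=> [|a u v]; rewrite /homogeneous /= ?linear0 ?scaler0 // linearP => -> ->.
by rewrite scalerDr !scalerA mulrC.
Qed.

Lemma grade_homogeneous n v : grade n v -> homogeneous n v.
Proof. by move=> /voa_L0. Qed.

Local Notation comp := (component (voa_direct_sum V)).

(** L(0) multiplies the component in V_n by n, so the component of L(0) v = r v is
    both r and n times that of v. *)
Lemma homogeneous_component r v n : homogeneous r v -> r != n%:Z -> comp v n = 0.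
Proof.
move=> vr rn; have [s us cs] := component_supp (voa_direct_sum V) v.
have L0c : component (voa_direct_sum V) (Y om 1 v) =1 fun n => n%:R *: comp v n.
  move=> k; rewrite (component_unique (voa_direct_sum V) us (f := fun n => n%:R *: comp v n)) //.
  - move=> i; apply: subspaceZ (component_in _ _ _).
    by case: (voa_direct_sum V).
  - by move=> i /cs ->; rewrite scaler0.
  - rewrite {1}(component_sum (voa_direct_sum V) v) (fsum_seq us cs) linear_sum.
    by apply: eq_bigr => i _; apply: voa_L0; apply: component_in.
have := L0c n; rewrite vr -[_ *: v]addr0 componentP component0 addr0 => /eqP.
rewrite -subr_eq0 -scalerBl scaler_eq0 subr_eq0 pmulrn eqr_int (negPf rn) /=.
by move/eqP.
Qed.

Lemma homogeneous_grade r v : homogeneous r v -> v != 0 ->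
  exists2 n, r = n%:Z & grade n v.
Proof.
move=> vr v0; have [|nr] := pselect (exists n : nat, r = n%:Z).
  move=> [n rn]; exists n => //; have [s us cs] := component_supp (voa_direct_sum V) v.
  have c0 i : i != n -> comp v i = 0.
    by move=> ni; apply: (homogeneous_component vr); rewrite rn eqz_nat eq_sym.
  by rewrite (component_sum (voa_direct_sum V) v) (fsum1 c0); apply: component_in.
case/negP: v0; apply/eqP; rewrite (component_sum (voa_direct_sum V) v) fsbig1 // => n _.
by apply: (homogeneous_component vr); apply/eqP => rn; apply: nr; exists n.
Qed.

Lemma homogeneous_nat n v : homogeneous n%:Z v <-> grade n v.
Proof.
split=> [vn|]; last exact: grade_homogeneous.
have [->|v0] := eqVneq v 0; first by case: (voa_direct_sum V) => _ /(_ n)[].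
by have [m [->]] := homogeneous_grade vn v0.
Qed.

Lemma homogeneous_lt0 r v : homogeneous r v -> r < 0 -> v = 0.
Proof.
move=> vr r0; apply/eqP; apply: contraTT r0 => /(homogeneous_grade vr)[n ->] _.
by rewrite -leNgt.
Qed.

Lemma homogeneous_ind (P : set V) : subspace P ->
  (forall r v, homogeneous r v -> P v) -> forall v, P v.
Proof.
move=> sP Ph v; apply: (component_mem (dU := voa_direct_sum V)) => // n.
by apply: (Ph n); apply/homogeneous_nat; apply: component_in.
Qed.

Section Module.
Variables (M : lmodType K) (act : V -> int -> {linear M -> M}).
Hypothesis ax : weak_module_axioms Y (voa_vac V) om (voa_charge V) act.

(** The commutator formula with omega(j), j >= 0, stops at i = j because the
    binomial coefficient C(j, i) is 0 beyond. *)
Lemma act_omega_commutator (j : nat) u m w :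
  act om j (act u m w) = act u m (act om j w)
    + \sum_(i < j.+1) binomz K j i *: act (Y om i u) (j%:Z + m - i%:Z) w.
Proof.
apply/eqP; rewrite addrC -subr_eq (wm_commutator ax); apply/eqP.
by rewrite (@fsum_ord _ j.+1) // => i ji; rewrite binomz_nat_gt // scale0r.
Qed.

Lemma act_L0 r u n w : homogeneous r u ->
  act om 1 (act u n w) = act u n (act om 1 w) + (r - n - 1)%:~R *: act u n w.
Proof.
move=> ur; rewrite act_omega_commutator !big_ord_recr big_ord0 /= add0r.
rewrite binomz0 binomz1 scale1r subr0 (addrC 1 n) (wm_derivative ax) addrK ur.
rewrite (wm_actZ ax) scalerA mul1r -scaleNr -scalerDl; congr (_ + _ *: _).
by rewrite !rmorphD /= !rmorphN; ring.
Qed.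

Lemma act_L1 r u n w : homogeneous r u ->
  act om 2 (act u n w) = act u n (act om 2 w) + act (Y om 2 u) n w
    + (2 * r - n - 2)%:~R *: act u (n + 1) w.
Proof.
move=> ur; rewrite act_omega_commutator !big_ord_recr big_ord0 /= add0r.
have C22 : binomz K 2 2 = 1.
  have n2 : 2 != 0 :> K by rewrite pnatr_eq0.
  by apply: (mulfI n2); rewrite (binomz_recr K 2 1) binomz1 mulr1 mul1r.
rewrite binomz0 binomz1 C22 !scale1r subr0 (addrC 2 n) (wm_derivative ax) addrK ur.
have -> : n + 2 - 1 = n + 1 by ring.
rewrite (wm_actZ ax) scalerA -scaleNr -scalerDl -!addrA; congr (_ + _).
rewrite addrC; congr (_ + _ *: _).
by rewrite !rmorphD /= !rmorphN rmorphM /=; ring.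
Qed.

End Module.

Lemma homogeneous_Y r s u v n : homogeneous r u -> homogeneous s v ->
  homogeneous (r + s - n - 1) (Y u n v).
Proof.
move=> ur vs; rewrite /homogeneous /= (act_L0 (voa_adjoint V) _ _ ur) vs linearZ /=.
by rewrite -scalerDl; congr (_ *: _); rewrite !rmorphD /= !rmorphN; ring.
Qed.

Lemma homogeneous_omega : homogeneous 2 om.
Proof. exact: grade_homogeneous (voa_omega_grade V). Qed.

Lemma homogeneous_vac : homogeneous 0 (voa_vac V).
Proof. exact: grade_homogeneous (voa_vac_grade V). Qed.

End Grading.

(** * Conjugation by the exponential of L(1) *)

Section DividedPowers.
Variables (K : numFieldType) (V : voa K).
Local Notation Y := (@voa_Y K V).
Local Notation om := (voa_omega V).
Local Notation L1 := (Y om 2).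
Local Notation homogeneous := (@homogeneous K V).

Definition div_L1 j (v : V) : V := (j`!%:R : K)^-1 *: iter j L1 v.

Lemma div_L1_0 v : div_L1 0 v = v.
Proof. by rewrite /div_L1 fact0 invr1 scale1r. Qed.

Lemma L1_div j v : L1 (div_L1 j v) = j.+1%:R *: div_L1 j.+1 v.
Proof.
rewrite /div_L1 linearZ /= scalerA factS natrM invfM mulrA divff ?mul1r //.
by rewrite pnatr_eq0.
Qed.

Lemma div_L1P j a u v : div_L1 j (a *: u + v) = a *: div_L1 j u + div_L1 j v.
Proof.
rewrite /div_L1 scalerA mulrC -scalerA -scalerDr; congr (_ *: _).
by elim: j => //= j ->; rewrite linearP.
Qed.

HB.instance Definition _ j :=
  GRing.isLinear.Build K V V _ (div_L1 j) (fun a u v => div_L1P j a u v).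

Lemma homogeneous_div j r v : homogeneous r v -> homogeneous (r - j%:Z) (div_L1 j v).
Proof.
move=> vr; apply: subspaceZ; first exact: homogeneous_subspace.
elim: j => [|j IH] /=; first by rewrite subr0.
have := homogeneous_Y 2 (homogeneous_omega V) IH; congr (homogeneous _ _).
by lia.
Qed.

Lemma div_L1_supp_homogeneous r v j : homogeneous r v -> (`|r|%N < j)%N -> div_L1 j v = 0.
Proof. by move=> vr rj; apply: (homogeneous_lt0 (homogeneous_div j vr)); lia. Qed.

Lemma div_L1_supp v : exists n, forall j, (n <= j)%N -> div_L1 j v = 0.
Proof.
move: v; apply: homogeneous_ind => [|r v vr]; last first.
  by exists `|r|.+1%N => j; apply: div_L1_supp_homogeneous vr.
split; first by exists 0%N => j _; rewrite linear0.
move=> a u v [n un] [m vm]; exists (maxn n m) => j.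
by rewrite geq_max => /andP[/un uj /vm vj]; rewrite div_L1P uj vj scaler0 addr0.
Qed.

(** The coefficient of x^d in exp(x L(1)) u(n) exp(- x L(1)), for u of weight r. *)
Definition conj_L1 (r : int) d u n v : V := \sum_(e < d.+1)
  binomz K (2 * r - n - 2 - (d - e)%N%:Z) e *: Y (div_L1 (d - e) u) (n + e%:Z) v.

Lemma conj_L1P r d u n a v w :
  conj_L1 r d u n (a *: v + w) = a *: conj_L1 r d u n v + conj_L1 r d u n w.
Proof.
rewrite /conj_L1 scaler_sumr -big_split; apply: eq_bigr => e _.
by rewrite linearP scalerDr !scalerA mulrC.
Qed.

HB.instance Definition _ r d u n :=
  GRing.isLinear.Build K V V _ (conj_L1 r d u n)
    (fun a v w => conj_L1P r d u n a v w).

(** The commutator with L(1) turns (L(1)^(j)u)(n + e) into a multiple of the same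
    with j + 1 and one of the same with e + 1.  The two contributions to a given
    term add up by Pascal's rule. *)
Lemma L1_conj r d u n v : homogeneous r u ->
  L1 (conj_L1 r d u n v) = conj_L1 r d u n (L1 v) + d.+1%:R *: conj_L1 r d.+1 u n v.
Proof.
move=> ur; pose Z e := Y (div_L1 (d.+1 - e) u) (n + e%:Z) v.
pose c e (j : nat) : K := binomz K (2 * r - n - 2 - j%:Z) e.
have step e : (e < d.+1)%N -> L1 (Y (div_L1 (d - e) u) (n + e%:Z) v)
    = Y (div_L1 (d - e) u) (n + e%:Z) (L1 v) + ((d.+1 - e)%:R *: Z e
      + (2 * (r - (d - e)%N%:Z) - (n + e%:Z) - 2)%:~R *: Z e.+1).
  move=> ed; rewrite (act_L1 (voa_adjoint V) _ _ (homogeneous_div _ ur)) -addrA.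
  rewrite L1_div (wm_actZ (voa_adjoint V)) /Z subSS subSn //.
  by congr (_ + (_ + _ *: Y _ _ _)); lia.
rewrite {1}/conj_L1 linear_sum.
transitivity (\sum_(e < d.+1) (c e (d - e)%N *: Y (div_L1 (d - e) u) (n + e%:Z) (L1 v)
   + ((c e (d - e)%N * (d.+1 - e)%:R) *: Z e
   + (c e (d - e)%N * (2 * (r - (d - e)%N%:Z) - (n + e%:Z) - 2)%:~R) *: Z e.+1))).
  apply: eq_bigr => e _; rewrite linearZ /= step ?ltn_ord //.
  by rewrite !scalerDr !scalerA.
rewrite big_split /=; congr (_ + _); rewrite big_split /=.
pose f1 e := (c e (d - e)%N * (d.+1 - e)%:R) *: Z e.
have -> : \sum_(e < d.+1) (c e (d - e)%N * (d.+1 - e)%:R) *: Z e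
    = \sum_(e < d.+2) f1 e.
  by rewrite [RHS]big_ord_recr /= /f1 subnn mulr0 scale0r addr0.
rewrite [X in X + _]big_ord_recl /conj_L1 [in RHS]big_ord_recl scalerDr.
rewrite -addrA -big_split scaler_sumr /f1; congr (_ + _).
  by rewrite /c !binomz0 mul1r scale1r.
apply: eq_bigr => e _ /=; rewrite /bump /= add1n !subSS -/(Z e.+1) -scalerDl.
rewrite scalerA; congr (_ *: _).
have ed : (e <= d)%N by rewrite -ltnS.
pose N := 2 * r - n - 2 - (d - e)%N%:Z; pose j : K := (d - e)%:R.
have -> : c e.+1 (d - e.+1)%N * (d - e)%:R = (binomz K N e.+1 + binomz K N e) * j.
  have [de|de] := posnP (d - e); first by rewrite /j de !mulr0.
  by rewrite -binomzS /c /N; congr (binomz _ _ _ * _); lia.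
have -> : (2 * (r - (d - e)%N%:Z) - (n + e%:Z) - 2)%:~R = N%:~R - j - e%:R :> K.
  by rewrite /j !pmulrn -!rmorphB /=; congr (_%:~R); rewrite /N; lia.
have -> : d.+1%:R = j + e%:R + 1 :> K.
  by rewrite /j -natrD subnK // natr1.
have := binomz_recr K N e; rewrite rmorphB /= -pmulrn -natr1 /c -/N.
move: (binomz K N e.+1) (binomz K N e) => a b H.
transitivity (a * j + (N%:~R - e%:R) * b); first by ring.
by rewrite -H; ring.
Qed.

(** The coefficient of x^d in exp(x L(1)) u(n) v, with the exponential moved past
    u(n). *)
Lemma div_L1_Y r d u n v : homogeneous r u ->
  div_L1 d (Y u n v) = \sum_(k < d.+1) conj_L1 r (d - k) u n (div_L1 k v).
Proof.
move=> ur; elim: d => [|d IH].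
  rewrite big_ord1 !div_L1_0 /conj_L1 big_ord1 binomz0 scale1r addr0 subnn.
  by rewrite !div_L1_0.
have d0 : d.+1%:R != 0 :> K by rewrite pnatr_eq0.
apply: (scalerI d0); rewrite -L1_div IH linear_sum scaler_sumr.
pose G k := conj_L1 r (d.+1 - k) u n (div_L1 k v).
transitivity (\sum_(k < d.+1) (k.+1%:R *: G k.+1 + (d.+1 - k)%:R *: G k)).
  apply: eq_bigr => k _; rewrite L1_conj // L1_div linearZ /= /G subSS subSn //.
  by rewrite -ltnS.
rewrite big_split /=.
have -> : \sum_(k < d.+1) k.+1%:R *: G k.+1 = \sum_(k < d.+2) k%:R *: G k.
  by rewrite [RHS]big_ord_recl scale0r add0r.
have -> : \sum_(k < d.+1) (d.+1 - k)%:R *: G k = \sum_(k < d.+2) (d.+1 - k)%:R *: G k.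
  by rewrite [RHS]big_ord_recr /= subnn scale0r addr0.
rewrite -big_split; apply: eq_bigr => k _ /=.
by rewrite -scalerDl -natrD subnKC // -ltnS.
Qed.

End DividedPowers.

(** * The opposite modes *)

Section Signs.
Variable K : numFieldType.
Local Notation sg z := ((-1 : K) ^ (z : int)).

Lemma signzD a b : sg (a + b) = sg a * sg b.
Proof. by rewrite exprzDr // unitrN1. Qed.

Lemma signzN a : sg (- a) = sg a.
Proof. by rewrite -exprz_inv invrN invr1. Qed.

Lemma signzz a : sg a * sg a = 1.
Proof. by rewrite -{2}(opprK a) signzN -signzD subrr. Qed.

End Signs.

Section Opposite.
Variables (K : numFieldType) (V : voa K).
Local Notation Y := (@voa_Y K V).
Local Notation om := (voa_omega V).
Local Notation homogeneous := (@homogeneous K V).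
Local Notation sg z := ((-1 : K) ^ (z : int)).
Local Notation ax := (voa_adjoint V).
Local Notation dV := (voa_direct_sum V).

Section Core.
Variables (r s : int) (u v x : V) (q : int) (N : nat).
Hypotheses (ur : homogeneous r u) (vs : homogeneous s v).
Hypothesis Nu : forall j, (N <= j)%N -> div_L1 j u = 0.
Hypothesis Nv : forall k, (N <= k)%N -> div_L1 k v = 0.
Hypothesis Nuv : forall j k l, (N <= l)%N ->
  Y (div_L1 j u) (q + l%:Z) (div_L1 k v) = 0.

(** The sum over the powers of L(1) applied to u(q + i) v, regrouped by the powers j
    and k that fall on u and v and by the shift e of the mode of u. *)
Lemma sum_div_L1_Y (i : nat) (w : int) :
  \sum_(d < N + N + (N + N)) Y (div_L1 d (Y u (q + i%:Z) v)) (w - d%:Z) x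
  = \sum_(k < N) \sum_(j < N) \sum_(e < N)
      binomz K (2 * r - (q + i%:Z) - 2 - j%:Z) e *:
      Y (Y (div_L1 j u) (q + (i + e)%N%:Z) (div_L1 k v))
        (w - (i + e)%N%:Z - k%:Z - j%:Z + i%:Z) x.
Proof.
pose H k e j := binomz K (2 * r - (q + i%:Z) - 2 - j%:Z) e *:
      Y (Y (div_L1 j u) (q + i%:Z + e%:Z) (div_L1 k v)) (w - (k + (e + j))%N%:Z) x.
have H0 k e j : (N <= k)%N || (N <= e)%N || (N <= j)%N -> H k e j = 0.
  rewrite /H; case/orP => [/orP[Nk|Ne]|Nj].
  - by rewrite Nv // linear0 (wm_act0 ax) scaler0.
  - have -> : q + i%:Z + e%:Z = q + (i + e)%N%:Z by lia.
    by rewrite Nuv ?(wm_act0 ax) ?scaler0 //; apply: leq_trans Ne (leq_addl _ _).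
  - by rewrite Nu // (wm_act0 ax) (wm_act0 ax) scaler0.
pose G k e := \sum_(f < e.+1) H k f (e - f)%N.
transitivity (\sum_(d < N + N + (N + N)) \sum_(k < d.+1) G k (d - k)%N).
  apply: eq_bigr => d _; rewrite (div_L1_Y _ _ _ ur) (wm_act_sum ax).
  apply: eq_bigr => k _; rewrite /conj_L1 (wm_act_sum ax) /G.
  apply: eq_bigr => e _; rewrite (wm_actZ ax) /H; congr (_ *: Y _ (_ - _) _).
  by have := ltn_ord k; have := ltn_ord e; rewrite !ltnS; lia.
rewrite sum_antidiagonal; last first.
  move=> k e ke; rewrite /G big1 // => f _; apply: H0.
  case/orP: ke => [Nk|Ne]; first by rewrite (leq_trans _ Nk) ?leq_addr.
  by have := ltn_ord f; move: Ne; lia.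
rewrite (@sum_ord_widen _ N (N + N) (fun k => \sum_(e < N + N) G k e)) ?leq_addr //; last first.
  move=> k Nk; rewrite big1 // => e _; rewrite /G big1 // => f _.
  by rewrite H0 // Nk.
apply: eq_bigr => k _; rewrite (@sum_antidiagonal _ N (fun f j => H k f j)); last first.
  by move=> f j fj; rewrite H0 // -orbA fj orbT.
rewrite exchange_big; apply: eq_bigr => j _; apply: eq_bigr => e _.
by rewrite /H; congr (_ *: Y (Y _ _ _) _ _); lia.
Qed.

End Core.

(** The opposite modes: for v of weight r, opmode v m is the coefficient of
    z^(-m-1) in Y(exp(z L(1)) (- z^(-2))^(L(0)) v, z^(-1)). *)
Definition opmode_sum v (m : int) x : V := \sum_(n \in [set: nat])
  sg n%:Z *: \sum_(j < n.+1)
    Y (div_L1 j (component dV v n)) (2 * n%:Z - m - 2 - j%:Z) x.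

Lemma component_bound v : exists N, forall n, (N <= n)%N -> component dV v n = 0.
Proof.
have [s us cs] := component_supp dV v; exists (\max_(n <- s) n).+1 => n sn.
by apply: cs; apply: contraTN sn => ns; rewrite -ltnNge ltnS (leq_bigmax_seq (F := id)).
Qed.

Lemma opmode_sum_supp v m x : eventually0 (fun n : nat => sg n%:Z *: \sum_(j < n.+1)
    Y (div_L1 j (component dV v n)) (2 * n%:Z - m - 2 - j%:Z) x).
Proof.
have [N NP] := component_bound v; exists N => n /NP ->.
by rewrite big1 ?scaler0 // => j _; rewrite linear0 (wm_act0 ax).
Qed.

Lemma opmode_sumP v m a x y :
  opmode_sum v m (a *: x + y) = a *: opmode_sum v m x + opmode_sum v m y.
Proof.
rewrite /opmode_sum -fsumZ -?fsumD; try exact: (opmode_sum_supp v m _).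
  apply: eq_fsbigr => n _; rewrite scalerA [a * _]mulrC -scalerA -scalerDr; congr (_ *: _).
  by rewrite scaler_sumr -big_split; apply: eq_bigr => j _; rewrite linearP.
exact: (eventually0Z (fun=> a) (opmode_sum_supp v m x)).
Qed.

HB.instance Definition _ v m :=
  GRing.isLinear.Build K V V _ (opmode_sum v m) (fun a x y => opmode_sumP v m a x y).

Definition opmode v m : {linear V -> V} := opmode_sum v m.

Lemma opmode_left a u v m x : opmode (a *: u + v) m x = a *: opmode u m x + opmode v m x.
Proof.
rewrite /opmode /= /opmode_sum -fsumZ -?fsumD; try exact: opmode_sum_supp.
  apply: eq_fsbigr => n _; rewrite scalerA [a * _]mulrC -scalerA -scalerDr; congr (_ *: _).
  rewrite scaler_sumr -big_split; apply: eq_bigr => j _.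
  by rewrite componentP div_L1P (wm_linear ax).
exact: (eventually0Z (fun=> a) (opmode_sum_supp u m x)).
Qed.

Lemma opmode0 m x : opmode 0 m x = 0.
Proof.
by have := opmode_left (-1) 0 0 m x; rewrite scaler0 addr0 scaleN1r addNr.
Qed.

(** The bound N is left free so that one bound serves several vectors. *)
Lemma opmode_homogeneous r v m x N : homogeneous r v ->
  (forall j, (N <= j)%N -> div_L1 j v = 0) ->
  opmode v m x = sg r *: \sum_(j < N) Y (div_L1 j v) (2 * r - m - 2 - j%:Z) x.
Proof.
move=> vr Nv; have [->|v0] := eqVneq v 0.
  by rewrite opmode0 big1 ?scaler0 // => j _; rewrite linear0 (wm_act0 ax).
have [n rn vn] := homogeneous_grade vr v0; subst r.
rewrite /opmode /= /opmode_sum (@fsum1 _ _ _ n); last first.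
  move=> k /negPf kn; rewrite big1 ?scaler0 // => j _.
  by rewrite (component_id dV _ vn) kn linear0 (wm_act0 ax).
rewrite (component_id dV _ vn) eqxx; congr (_ *: _).
pose F j := Y (div_L1 j v) (2 * n%:Z - m - 2 - j%:Z) x.
rewrite -(@fsum_ord _ n.+1 F); last first.
  by move=> j nj; rewrite /F (div_L1_supp_homogeneous vr) ?(wm_act0 ax).
by rewrite (@fsum_ord _ N F) // => j Nj; rewrite /F Nv // (wm_act0 ax).
Qed.

Lemma opmode_supp v m x : eventually0 (fun i : nat => opmode v (m - i%:Z) x).
Proof.
move: v; apply: homogeneous_ind.
  split; first by exists 0%N => i _; rewrite opmode0.
  move=> a u v u0 v0; under [X in eventually0 X]funext do rewrite opmode_left.
  by apply: eventually0D => //; apply: (eventually0Z (fun=> a)).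
move=> r v vr; have [N NP] := div_L1_supp v.
suff [N' NP'] : exists N', forall j i, (N' <= i)%N ->
    Y (div_L1 j v) (2 * r - (m - i%:Z) - 2 - j%:Z) x = 0.
  by exists N' => i Ni; rewrite (opmode_homogeneous _ _ vr NP) big1 ?scaler0 // => j _; rewrite NP'.
have /choice[f fP] j : exists n, forall i, (n <= i)%N ->
    Y (div_L1 j v) (2 * r - (m - i%:Z) - 2 - j%:Z) x = 0.
  have [n nP] := wm_truncation_nat ax (div_L1 j v) (2 * r - m - 2 - j%:Z) x.
  by exists n => i /nP; congr (Y _ _ _ = _); lia.
exists (\max_(j < N) f j) => j i fi; have [Nj|jN] := leqP N j.
  by rewrite NP // (wm_act0 ax).
by apply: fP; apply: leq_trans fi; apply: (leq_bigmax (Ordinal jN)).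
Qed.

End Opposite.

Section OppositeBorcherds.
Variables (K : numFieldType) (V : voa K).
Local Notation Y := (@voa_Y K V).
Local Notation om := (voa_omega V).
Local Notation homogeneous := (@homogeneous K V).
Local Notation sg z := ((-1 : K) ^ (z : int)).
Local Notation ax := (voa_adjoint V).

Definition opmode_borcherds_l u v x (p q t : int) : V := \sum_(i \in [set: nat])
  binomz K p i *: opmode (Y u (q + i%:Z) v) (p + t - i%:Z) x.

Definition opmode_borcherds_r u v x (p q t : int) : V := \sum_(i \in [set: nat])
  ((-1) ^+ i * binomz K q i) *: (opmode v (t + i%:Z) (opmode u (p + q - i%:Z) x)
     - sg q *: opmode u (p + i%:Z) (opmode v (q + t - i%:Z) x)).

Lemma uniform_bound (u v : V) (q : int) : exists N : nat,
  [/\ forall j, (N <= j)%N -> div_L1 j u = 0,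
      forall k, (N <= k)%N -> div_L1 k v = 0 &
      forall j k l, (N <= l)%N -> Y (div_L1 j u) (q + l%:Z) (div_L1 k v) = 0].
Proof.
have [N1 N1u] := div_L1_supp u; have [N2 N2v] := div_L1_supp v.
have /choice[f fP] (jk : nat * nat) : exists n, forall i, (n <= i)%N ->
    Y (div_L1 jk.1 u) (q + i%:Z) (div_L1 jk.2 v) = 0.
  exact: (wm_truncation_nat ax).
pose N3 := \max_(j < N1) \max_(k < N2) f (val j, val k).
exists (maxn (maxn N1 N2) N3); split=> [j|k|j k l]; rewrite !geq_max -!andbA => /and3P[h1 h2 h3].
- exact: N1u.
- exact: N2v.
have [jN|jN] := leqP N1 j; first by rewrite N1u // (wm_act0 ax).
have [kN|kN] := leqP N2 k; first by rewrite N2v // linear0.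
apply: (fP (j, k)); apply: leq_trans h3.
rewrite /N3; apply: leq_trans (leq_bigmax (Ordinal jN)) => /=.
exact: (@leq_bigmax _ (fun k => f (j, val k)) (Ordinal kN)).
Qed.

Section Homogeneous.
Variables (r s : int) (u v : V).
Hypotheses (ur : homogeneous r u) (vs : homogeneous s v).

(** In terms of test functions, the identity with exponents (p, q, t) for
    x^p y^t (x - y)^q becomes, after x and y are replaced by their inverses, one for
    x^P y^T (y - x)^q.  The weights and the powers j, k of L(1) enter P and T through
    the factors z^(-2 L(0)) and exp(z L(1)). *)
Lemma opmode_borcherds_r_homogeneous N x p q t :
  (forall j, (N <= j)%N -> div_L1 j u = 0) ->
  (forall k, (N <= k)%N -> div_L1 k v = 0) ->
  opmode_borcherds_r u v x p q t = - (sg (r + s) * sg q) *: \sum_(j < N) \sum_(k < N)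
    borcherds_r Y (div_L1 j u) (div_L1 k v) x
      (2 * r - 2 - j%:Z - p - q) q (2 * s - 2 - k%:Z - q - t).
Proof.
move=> Nu Nv; have du m y := opmode_homogeneous m y ur Nu.
have dv m y := opmode_homogeneous m y vs Nv; rewrite scaler_sumr.
under [RHS]eq_bigr do rewrite scaler_sumr.
pose P (j : nat) := 2 * r - 2 - j%:Z - p - q; pose T (k : nat) := 2 * s - 2 - k%:Z - q - t.
pose A j k (i : nat) := Y (div_L1 j u) (P j + q - i%:Z) (Y (div_L1 k v) (T k + i%:Z) x).
pose B j k (i : nat) := Y (div_L1 k v) (q + T k - i%:Z) (Y (div_L1 j u) (P j + i%:Z) x).
pose c i : K := (-1) ^+ i * binomz K q i; pose C := - (sg (r + s) * sg q).
pose F j k i := C *: (c i *: (A j k i - sg q *: B j k i)).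
have F1 j k : eventually0 (fun i => c i *: (A j k i - sg q *: B j k i)).
  apply: eventually0Z; rewrite /A /B.
  under [X in eventually0 X]funext do rewrite -scaleNr.
  apply: eventually0D; first exact: (borcherds_r_supp ax _ _ _ (fun i => P j + q - i)).
  by apply: eventually0Z; exact: (borcherds_r_supp ax _ _ _ (fun i => q + T k - i)).
have F0 j k : eventually0 (F j k) by exact: (eventually0Z (fun=> C)).
transitivity (\sum_(i \in [set: nat]) \sum_(j < N) \sum_(k < N) F j k i).
  apply: eq_fsbigr => i _.
  rewrite (du (p + q - i%:Z)) (dv (q + t - i%:Z)).
  rewrite !linearZ /= (du (p + i%:Z)) (dv (t + i%:Z)).
  have -> : \sum_(j < N) \sum_(k < N) F j k i
    = c i *: (C *: \sum_(j < N) \sum_(k < N) A j k i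
              - (C * sg q) *: \sum_(j < N) \sum_(k < N) B j k i).
    rewrite -scalerA -scalerBr scaler_sumr -sumrB !scaler_sumr; apply: eq_bigr => j _.
    rewrite scaler_sumr -sumrB !scaler_sumr; apply: eq_bigr => k _.
    by rewrite /F !scalerA mulrC.
  congr (_ *: _).
  have -> : \sum_(j < N) Y (div_L1 j u) (2 * r - (p + q - i%:Z) - 2 - j%:Z) x
      = \sum_(j < N) Y (div_L1 j u) (P j + i%:Z) x.
    by apply: eq_bigr => j _; congr (Y _ _ _); rewrite /P; lia.
  have -> : \sum_(j < N) Y (div_L1 j v) (2 * s - (q + t - i%:Z) - 2 - j%:Z) x
      = \sum_(j < N) Y (div_L1 j v) (T j + i%:Z) x.
    by apply: eq_bigr => j _; congr (Y _ _ _); rewrite /T; lia.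
  have -> : \sum_(j < N) Y (div_L1 j u) (2 * r - (p + i%:Z) - 2 - j%:Z)
      (\sum_(k < N) Y (div_L1 k v) (T k + i%:Z) x) = \sum_(j < N) \sum_(k < N) A j k i.
    apply: eq_bigr => j _; rewrite linear_sum; apply: eq_bigr => k _.
    by rewrite /A; congr (Y _ _ _); rewrite /P; lia.
  have -> : \sum_(k < N) Y (div_L1 k v) (2 * s - (t + i%:Z) - 2 - k%:Z)
      (\sum_(j < N) Y (div_L1 j u) (P j + i%:Z) x) = \sum_(j < N) \sum_(k < N) B j k i.
    rewrite [RHS]exchange_big; apply: eq_bigr => k _; rewrite linear_sum.
    by apply: eq_bigr => j _; rewrite /B; congr (Y _ _ _); rewrite /T; lia.
  move: (\sum_(j < N) \sum_(k < N) A j k i) (\sum_(j < N) \sum_(k < N) B j k i).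
  move=> SA SB; transitivity ((sg r * sg s) *: SB - (sg q * sg s * sg r) *: SA).
    by rewrite !scalerN !scalerA.
  rewrite addrC; congr (_ + _).
    by rewrite -scaleNr /C signzD; congr (_ *: _); ring.
  rewrite -scaleNr /C signzD; congr (_ *: _).
  by rewrite mulNr opprK -[_ * sg q * sg q]mulrA signzz mulr1.
rewrite fsum_sum; last first.
  by move=> j; apply: eventually0_sum.
apply: eq_bigr => j _; rewrite fsum_sum //; apply: eq_bigr => k _.
by rewrite /borcherds_r -fsumZ //; apply: F1.
Qed.

(** Write u_j, v_k for the divided powers of L(1) applied to u and v.  The vector
    (u_j(q + l) v_k)(P + T - l) x occurs once for every i <= l; by Vandermonde its
    coefficients add up to the binomial coefficient C(P, l) of the Borcherds identity
    for u_j and v_k. *)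
Lemma opmode_borcherds_l_homogeneous N x p q t :
  (forall j, (N <= j)%N -> div_L1 j u = 0) ->
  (forall k, (N <= k)%N -> div_L1 k v = 0) ->
  (forall j k l, (N <= l)%N -> Y (div_L1 j u) (q + l%:Z) (div_L1 k v) = 0) ->
  opmode_borcherds_l u v x p q t = - (sg (r + s) * sg q) *: \sum_(j < N) \sum_(k < N)
    borcherds_l Y (div_L1 j u) (div_L1 k v) x
      (2 * r - 2 - j%:Z - p - q) q (2 * s - 2 - k%:Z - q - t).
Proof.
move=> Nu Nv Nuv; pose Z j k l := Y (Y (div_L1 j u) (q + l%:Z) (div_L1 k v))
  (2 * r - 2 - j%:Z - p - q + (2 * s - 2 - k%:Z - q - t) - l%:Z) x.
have Z0 j k l : (N <= l)%N -> Z j k l = 0 by move=> Nl; rewrite /Z Nuv // (wm_act0 ax).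
have uv0 i : (N <= i)%N -> Y u (q + i%:Z) v = 0.
  by move=> Ni; have := Nuv 0%N 0%N _ Ni; rewrite !div_L1_0.
pose w i := r + s - (q + i%:Z) - 1.
rewrite /opmode_borcherds_l (@fsum_ord _ N); last first.
  by move=> i Ni; rewrite uv0 // opmode0 scaler0.
pose b i j e : K := binomz K p i * sg (w i) * binomz K (2 * r - (q + i%:Z) - 2 - j%:Z) e.
transitivity (\sum_(i < N) \sum_(k < N) \sum_(j < N) \sum_(e < N)
    b i j e *: Z j k (i + e)%N).
  apply: eq_bigr => i _; have yw := homogeneous_Y (q + i%:Z) ur vs.
  have yd d : (N + N + (N + N) <= d)%N -> div_L1 d (Y u (q + i%:Z) v) = 0.
    move=> Nd; rewrite (div_L1_Y _ _ _ ur) big1 // => k _.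
    rewrite /conj_L1 big1 // => e _; have := ltn_ord k; have := ltn_ord e.
    rewrite !ltnS => ek kd; have [Nk|kN] := leqP N k.
      by rewrite Nv // linear0 scaler0.
    have [Ne|eN] := leqP N e.
      have -> : q + i%:Z + e%:Z = q + (i + e)%N%:Z by lia.
      by rewrite Nuv ?scaler0 //; lia.
    by rewrite Nu ?(wm_act0 ax) ?scaler0 //; lia.
  rewrite (opmode_homogeneous _ _ yw yd) (sum_div_L1_Y _ ur) // scalerA scaler_sumr.
  apply: eq_bigr => k _; rewrite scaler_sumr; apply: eq_bigr => j _.
  rewrite scaler_sumr; apply: eq_bigr => e _; rewrite scalerA /b /Z.
  by congr (_ *: Y _ _ _); rewrite /w; lia.
rewrite scaler_sumr.
transitivity (\sum_(j < N) \sum_(k < N) \sum_(i < N) \sum_(e < N)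
    b i j e *: Z j k (i + e)%N).
  rewrite exchange_big [RHS]exchange_big /=; apply: eq_bigr => k _.
  by rewrite exchange_big.
apply: eq_bigr => j _; rewrite scaler_sumr; apply: eq_bigr => k _.
rewrite -(@sum_antidiagonal _ N (fun i e => b i j e *: Z j k (i + e)%N)); last first.
  move=> i e ie; rewrite Z0 ?scaler0 //.
  by case/orP: ie => H; apply: leq_trans H _; [apply: leq_addr|apply: leq_addl].
rewrite /borcherds_l (@fsum_ord _ (N + N)); last first.
  by move=> l Nl; rewrite Nuv ?(wm_act0 ax) ?scaler0 //; apply: leq_trans Nl; apply: leq_addr.
rewrite scaler_sumr; apply: eq_bigr => l _.
rewrite scalerA -/(Z j k l).
rewrite -[2 * r - 2 - j%:Z - p - q](_ : 2 * r - 2 - j%:Z - q - p = _); last by lia.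
rewrite -binomz_Vandermonde mulr_sumr scaler_suml.
apply: eq_bigr => i _; rewrite subnKC; last by rewrite -ltnS.
congr (_ *: _); rewrite /b.
have -> : 2 * r - (q + i%:Z) - 2 - j%:Z = 2 * r - 2 - j%:Z - q - i%:Z by lia.
have -> : w i = r + s + - (q + i%:Z + 1) by rewrite /w; lia.
by rewrite signzD signzN !signzD expr1z -exprnP; ring.
Qed.

Lemma opmode_borcherds_homogeneous x p q t :
  opmode_borcherds_l u v x p q t = opmode_borcherds_r u v x p q t.
Proof.
have [N [Nu Nv Nuv]] := uniform_bound u v q.
rewrite (opmode_borcherds_l_homogeneous _ _ _ Nu Nv Nuv).
rewrite (opmode_borcherds_r_homogeneous _ _ _ _ Nu Nv).
congr (_ *: _); apply: eq_bigr => j _; apply: eq_bigr => k _.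
exact: (borcherds ax).
Qed.

End Homogeneous.

(** Both sides are bilinear in u and v, and for homogeneous u and v they are the same
    combination of Borcherds identities in V.  Products of opposite modes come in
    reversed order, so that transposed they form a module. *)
Lemma opmode_borcherds u v x p q t :
  opmode_borcherds_l u v x p q t = opmode_borcherds_r u v x p q t.
Proof.
have l0 u' v' : eventually0 (fun i : nat =>
    binomz K p i *: opmode (Y u' (q + i%:Z) v') (p + t - i%:Z) x).
  have [N NP] := wm_truncation_nat ax u' q v'; exists N => i /NP ->.
  by rewrite opmode0 scaler0.
have r0 u' v' : eventually0 (fun i : nat =>
    ((-1) ^+ i * binomz K q i) *: (opmode v' (t + i%:Z) (opmode u' (p + q - i%:Z) x)
     - sg q *: opmode u' (p + i%:Z) (opmode v' (q + t - i%:Z) x))).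
  apply: eventually0Z; under [X in eventually0 X]funext do rewrite -scaleNr.
  apply: eventually0D.
    by have [N NP] := opmode_supp u' (p + q) x; exists N => i /NP ->; rewrite linear0.
  apply: (eventually0Z (fun=> - sg q)).
  by have [N NP] := opmode_supp v' (q + t) x; exists N => i /NP ->; rewrite linear0.
have lP a u1 u2 v1 : opmode_borcherds_l (a *: u1 + u2) v1 x p q t
    = a *: opmode_borcherds_l u1 v1 x p q t + opmode_borcherds_l u2 v1 x p q t.
  rewrite /opmode_borcherds_l -fsumZ // -fsumD //; last exact: (eventually0Z (fun=> a)).
  apply: eq_fsbigr => i _.
  by rewrite (wm_linear ax) opmode_left scalerDr !scalerA mulrC.
have rP a u1 u2 v1 : opmode_borcherds_r (a *: u1 + u2) v1 x p q t
    = a *: opmode_borcherds_r u1 v1 x p q t + opmode_borcherds_r u2 v1 x p q t.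
  rewrite /opmode_borcherds_r -fsumZ // -fsumD //; last exact: (eventually0Z (fun=> a)).
  apply: eq_fsbigr => i _; rewrite (opmode_left a u1 u2 (p + q - i%:Z) x).
  rewrite (opmode_left a u1 u2 (p + i%:Z)) (linearP (opmode v1 (t + i%:Z))).
  move: ((-1) ^+ i * _) => c; rewrite scalerA mulrC -scalerA -scalerDr; congr (_ *: _).
  by rewrite scalerDr opprD scalerBr addrACA !scalerA (mulrC a).
have lP' a u1 v1 v2 : opmode_borcherds_l u1 (a *: v1 + v2) x p q t
    = a *: opmode_borcherds_l u1 v1 x p q t + opmode_borcherds_l u1 v2 x p q t.
  rewrite /opmode_borcherds_l -fsumZ // -fsumD //; last exact: (eventually0Z (fun=> a)).
  apply: eq_fsbigr => i _.
  by rewrite linearP opmode_left scalerDr !scalerA mulrC.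
have rP' a u1 v1 v2 : opmode_borcherds_r u1 (a *: v1 + v2) x p q t
    = a *: opmode_borcherds_r u1 v1 x p q t + opmode_borcherds_r u1 v2 x p q t.
  rewrite /opmode_borcherds_r -fsumZ // -fsumD //; last exact: (eventually0Z (fun=> a)).
  apply: eq_fsbigr => i _; rewrite (opmode_left a v1 v2 (q + t - i%:Z) x).
  rewrite (opmode_left a v1 v2 (t + i%:Z)) (linearP (opmode u1 (p + i%:Z))).
  move: ((-1) ^+ i * _) => c; rewrite scalerA mulrC -scalerA -scalerDr; congr (_ *: _).
  by rewrite scalerDr opprD scalerBr addrACA !scalerA (mulrC a).
have l00 v' : opmode_borcherds_l 0 v' x p q t = 0.
  by have := lP (-1) 0 0 v'; rewrite scaler0 addr0 scaleN1r addNr.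
have r00 v' : opmode_borcherds_r 0 v' x p q t = 0.
  by have := rP (-1) 0 0 v'; rewrite scaler0 addr0 scaleN1r addNr.
have l00' u' : opmode_borcherds_l u' 0 x p q t = 0.
  by have := lP' (-1) u' 0 0; rewrite scaler0 addr0 scaleN1r addNr.
have r00' u' : opmode_borcherds_r u' 0 x p q t = 0.
  by have := rP' (-1) u' 0 0; rewrite scaler0 addr0 scaleN1r addNr.
move: u; apply: homogeneous_ind => [|r u ur].
  by split=> [|a u1 u2 E1 E2] /=; rewrite ?l00 ?r00 // lP rP E1 E2.
move: v; apply: homogeneous_ind => [|s v vs].
  by split=> [|a u1 u2 E1 E2] /=; rewrite ?l00' ?r00' // lP' rP' E1 E2.
exact: opmode_borcherds_homogeneous ur vs _ _ _ _.
Qed.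

End OppositeBorcherds.

(** * Weak modules on subspaces, and quotient spaces *)

Section SubLmodule.
Variables (K : fieldType) (X : lmodType K) (P : set X) (sP : subspace P).

Definition sub_pred : {pred X} := fun x => `[< P x >].

Lemma sub_pred_closed : subsemimod_closed sub_pred.
Proof.
split; first split.
- by apply/asboolP; case: sP.
- by move=> u v /asboolP Pu /asboolP Pv; apply/asboolP; apply: subspaceD.
- by move=> a u /asboolP Pu; apply/asboolP; apply: subspaceZ.
Qed.

(** The proof is a parameter of the type, so that the vector space structure can be
    inferred from it. *)
Definition sub_lmod (_ : subspace P) := {x : X | x \in sub_pred}.
HB.instance Definition _ := SubType.on (sub_lmod sP).
HB.instance Definition _ := SubChoice.on (sub_lmod sP).
HB.instance Definition _ :=
  GRing.SubChoice_isSubLmodule.Build K X sub_pred (sub_lmod sP) sub_pred_closed.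

End SubLmodule.

Section SubWeakModule.
Variables (K : numFieldType) (V : voa K) (X : lmodType K).
Local Notation Y := (@voa_Y K V).
Local Notation om := (voa_omega V).
Variables (act : V -> int -> {linear X -> X}) (P : set X) (sP : subspace P).
Hypothesis stable : forall v n w, P w -> P (act v n w).

Definition sub_act_fun (v : V) (n : int) (w : sub_lmod sP) : sub_lmod sP :=
  Sub (act v n (\val w)) (asboolT (stable v n (asboolW (valP w)))).

Lemma val_sub_act v n w : \val (sub_act_fun v n w) = act v n (\val w).
Proof. by rewrite /sub_act_fun SubK. Qed.

Let val0 : \val (0 : sub_lmod sP) = 0 := linear0 _.
Let valD (u w : sub_lmod sP) : \val (u + w) = \val u + \val w := linearD _ u w.
Let valB (u w : sub_lmod sP) : \val (u - w) = \val u - \val w := linearB _ u w.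
Let valN (w : sub_lmod sP) : \val (- w) = - \val w := linearN _ w.
Let valZ a (w : sub_lmod sP) : \val (a *: w) = a *: \val w := linearZZ _ a w.

Lemma sub_act_linear v n : linear (sub_act_fun v n).
Proof.
by move=> a u w; apply: val_inj; rewrite valD valZ !val_sub_act valD valZ linearP.
Qed.

HB.instance Definition _ v n :=
  GRing.isLinear.Build K (sub_lmod sP) (sub_lmod sP) _ (sub_act_fun v n)
    (sub_act_linear v n).

Definition sub_act v n : {linear sub_lmod sP -> sub_lmod sP} := sub_act_fun v n.

Hypothesis lin : forall (a : K) (u v : V) n w, P w ->
  act (a *: u + v) n w = a *: act u n w + act v n w.
Hypothesis trunc : forall v w, P w ->
  exists N : int, forall n : int, N <= n -> act v n w = 0.
Hypothesis vacuum : forall n w, P w ->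
  act (voa_vac V) n w = if n == -1 then w else 0.
Hypothesis Virasoro : forall m n w, P w ->
  act om (m + 1) (act om (n + 1) w) - act om (n + 1) (act om (m + 1) w)
  = (m - n)%:~R *: act om (m + n + 1) w
    + (if m + n == 0 then ((m ^+ 3 - m)%:~R / 12%:R * voa_charge V) *: w else 0).
Hypothesis derivative : forall v n w, P w ->
  act (Y om 0 v) n w = - (n%:~R *: act v (n - 1) w).
Hypothesis commutator : forall u v m n w, P w ->
  act v n (act u m w) - act u m (act v n w)
  = \sum_(i \in [set: nat]) binomz K n i *: act (Y v i%:Z u) (n + m - i%:Z) w.
Hypothesis associativity : forall u v m n w, P w ->
  act (Y v n u) m w = \sum_(i \in [set: nat]) ((-1) ^+ i * binomz K n i) *:
    (act v (n - i%:Z) (act u (m + i%:Z) w)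
     - ((-1) ^ n : K) *: act u (n + m - i%:Z) (act v i%:Z w)).

Let val_fsum (F : nat -> sub_lmod sP) : eventually0 F ->
  \val (\sum_(i \in [set: nat]) F i) = \sum_(i \in [set: nat]) \val (F i).
Proof.
move=> [n Fn]; rewrite (fsum_ord Fn) (@fsum_ord _ n) ?linear_sum //.
by move=> i /Fn ->; rewrite linear0.
Qed.

Lemma sub_weak_module_axioms :
  weak_module_axioms Y (voa_vac V) om (voa_charge V) sub_act.
Proof.
have Pw (w : sub_lmod sP) : P (\val w) by apply: asboolW (valP w).
have lin' (a : K) (u v : V) n w :
    sub_act (a *: u + v) n w = a *: sub_act u n w + sub_act v n w.
  by apply: val_inj; rewrite valD valZ !val_sub_act lin.
have act0 n w : sub_act 0 n w = 0.
  by have := lin' (-1) 0 0 n w; rewrite scaler0 addr0 scaleN1r addNr.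
have trunc' v w : exists N : int, forall n : int, N <= n -> sub_act v n w = 0.
  have [N NP] := trunc v (Pw w); exists N => n Nn.
  by apply: val_inj; rewrite val_sub_act NP // val0.
have truncn v n w : exists N : nat, forall i : nat, (N <= i)%N ->
    sub_act v (n + i%:Z) w = 0.
  by have [N NP] := trunc' v w; exists `|N - n|%N => i Ni; apply: NP; lia.
split=> //.
- move=> n w; apply: val_inj; rewrite val_sub_act vacuum //.
  by case: ifP; rewrite // val0.
- move=> m n w; apply: val_inj; rewrite valB valD valZ !val_sub_act.
  by rewrite Virasoro //; case: ifP => _; rewrite ?valZ ?val0.
- move=> v n w; apply: val_inj; rewrite valN valZ !val_sub_act.
  exact: derivative.
- move=> u v m n w; apply: val_inj; rewrite valB !val_sub_act commutator //.
  rewrite val_fsum; first by apply: eq_fsbigr => i _; rewrite valZ val_sub_act.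
  have [N NP] := wm_truncation_nat (voa_adjoint V) v 0 u.
  by exists N => i /NP; rewrite add0r => ->; rewrite act0 scaler0.
- move=> u v m n w; apply: val_inj; rewrite val_sub_act associativity //.
  rewrite val_fsum.
    by apply: eq_fsbigr => i _; rewrite valZ valB valZ !val_sub_act.
  apply: eventually0Z.
  have [N NP] := truncn u m w; have [N' NP'] := truncn v 0 w.
  exists (maxn N N') => i; rewrite geq_max => /andP[/NP -> /NP'].
  by rewrite add0r => ->; rewrite !linear0 ?addr0.
Qed.

(** The axioms are asked on P only, because truncation and associativity fail on the
    spaces X to which this is applied. *)
Definition sub_weak_module : weak_module V := WeakModule sub_weak_module_axioms.

End SubWeakModule.

Section Quotient.
Variables (K : fieldType) (X : lmodType K) (P : set X).

Definition quot_pred (_ : subspace P) : {pred X} := sub_pred P.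
Variable sP : subspace P.

Lemma quot_pred_closed : zmod_closed (quot_pred sP).
Proof.
split; first by apply/asboolP; case: sP.
by move=> u v /asboolP Pu /asboolP Pv; apply/asboolP; apply: subspaceB.
Qed.

HB.instance Definition _ := GRing.isZmodClosed.Build X (quot_pred sP) quot_pred_closed.

Definition quot_lmod := Quotient.quot (quot_pred sP).
HB.instance Definition _ := GRing.Zmodule.on quot_lmod.
Definition quot_proj (x : X) : quot_lmod := (\pi_(Quotient.quot (quot_pred sP)) x)%qT.

Lemma quot_projP x y : quot_proj x = quot_proj y <-> P (x - y).
Proof.
rewrite /quot_proj; split => [/eqP|Pxy]; last apply/eqP.
  by rewrite piE /= Quotient.equivE => /asboolP.
by rewrite piE /= Quotient.equivE; apply/asboolP.
Qed.

Lemma quot_projD x y : quot_proj (x + y) = quot_proj x + quot_proj y.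
Proof. exact: Quotient.pi_add. Qed.

Lemma quot_proj_surj q : exists x, q = quot_proj x.
Proof. by exists (repr q); rewrite /quot_proj reprK. Qed.

Definition quot_scale (a : K) (q : quot_lmod) : quot_lmod :=
  quot_proj (a *: projT1 (cid (quot_proj_surj q))).

Lemma quot_scaleE a x : quot_scale a (quot_proj x) = quot_proj (a *: x).
Proof.
rewrite /quot_scale; case: cid => y /= /esym /quot_projP Pyx; apply/quot_projP.
by rewrite -scalerBr; apply: subspaceZ.
Qed.

Lemma quot_scaleA a b q : quot_scale a (quot_scale b q) = quot_scale (a * b) q.
Proof. by have [x ->] := quot_proj_surj q; rewrite !quot_scaleE scalerA. Qed.

Lemma quot_scale1 : left_id 1 quot_scale.
Proof. by move=> q; have [x ->] := quot_proj_surj q; rewrite quot_scaleE scale1r. Qed.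

Lemma quot_scaleDr : right_distributive quot_scale +%R.
Proof.
move=> a q q'; have [x ->] := quot_proj_surj q; have [y ->] := quot_proj_surj q'.
by rewrite -quot_projD !quot_scaleE scalerDr quot_projD.
Qed.

Lemma quot_scaleDl q : {morph quot_scale^~ q : a b / a + b}.
Proof.
move=> a b; have [x ->] := quot_proj_surj q.
by rewrite !quot_scaleE scalerDl quot_projD.
Qed.

HB.instance Definition _ := GRing.Zmodule_isLmodule.Build K quot_lmod
  quot_scaleA quot_scale1 quot_scaleDr quot_scaleDl.

Lemma quot_proj_linear : linear quot_proj.
Proof. by move=> a x y; rewrite quot_projD -quot_scaleE. Qed.

Lemma quot_proj_eq0 x : quot_proj x = 0 <-> P x.
Proof.
have -> : 0 = quot_proj 0.
  by rewrite -[0](scale0r (quot_proj 0)) -[_ *: _]/(quot_scale _ _) quot_scaleE scale0r.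
by rewrite quot_projP subr0.
Qed.

End Quotient.

(** * The dual module *)

Section OppositeSpecial.
Variables (K : numFieldType) (V : voa K).
Local Notation Y := (@voa_Y K V).
Local Notation om := (voa_omega V).
Local Notation vac := (voa_vac V).
Local Notation ax := (voa_adjoint V).

Lemma div_L1_supp1 v : Y om 2 v = 0 -> forall j, (1 <= j)%N -> div_L1 j v = 0.
Proof.
move=> v0 [|j] // _; rewrite /div_L1 iterSr v0.
suff -> : iter j (Y om 2) 0 = 0 by rewrite scaler0.
by elim: j => //= j ->; rewrite linear0.
Qed.

Lemma opmode_vac (m : int) x : opmode vac m x = if m == -1 then x else 0.
Proof.
have v0 : Y om 2 vac = 0 by rewrite voa_creation.
rewrite (opmode_homogeneous _ _ (homogeneous_vac V) (div_L1_supp1 v0)).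
rewrite big_ord1 div_L1_0 expr0z scale1r (wm_vacuum ax).
congr (if _ then _ else _); apply/eqP/eqP => /=; lia.
Qed.

Lemma L1_omega : Y om 2 om = 0.
Proof.
have omE : Y om (-1) vac = om by rewrite voa_creation.
have := wm_Virasoro ax 1 (-2) vac.
have -> : (-2 + 1 = -1 :> int) by []; have -> : (1 + 1 = 2 :> int) by [].
have -> : (1 - 2 + 1 = 0 :> int) by [].
by rewrite omE !voa_creation //= linear0 subr0 scaler0 addr0.
Qed.

Lemma opmode_omega (m : int) x : opmode om m x = Y om (2 - m) x.
Proof.
rewrite (opmode_homogeneous _ _ (homogeneous_omega V) (div_L1_supp1 L1_omega)).
rewrite big_ord1 div_L1_0 -exprnP sqrrN expr1n scale1r.
by congr (Y _ _ _) => /=; lia.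
Qed.

Lemma binomz_opp2 i : (-1) ^+ i * binomz K (-2) i = i.+1%:R.
Proof.
elim: i => [|i IH]; first by rewrite binomz0 mulr1.
have i0 : i.+1%:R != 0 :> K by rewrite pnatr_eq0.
apply: (mulfI i0); rewrite mulrCA binomz_recr mulrCA exprSr mulrN1 mulNr IH.
have -> : (-2 - i%:Z)%:~R = - i.+2%:R :> K.
  by rewrite [i.+2%:R]pmulrn -mulrNz; congr (_%:~R); lia.
by rewrite mulrNN mulrC.
Qed.

Lemma Y_omega0 v : Y om 0 v = Y v (-2) vac.
Proof.
have := wm_derivative ax v (-1) vac; rewrite voa_creation //= => ->.
by rewrite mulrN1z scaleN1r opprK.
Qed.

(** Since L(-1) v = v(-2) 1, this is associativity for v and the vacuum: one term of
    the sum survives. *)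
Lemma opmode_derivative v (n : int) x : opmode (Y om 0 v) n x = - (n%:~R *: opmode v (n - 1) x).
Proof.
have := opmode_borcherds v vac x 0 (-2) n; rewrite /opmode_borcherds_l /opmode_borcherds_r.
rewrite (@fsum1 _ _ _ 0%N); last by case=> // i _; rewrite binomz0S scale0r.
rewrite binomz0 scale1r addr0 add0r subr0 -Y_omega0 => ->.
have -> : (-1 : K) ^ (-2) = 1 by rewrite -exprz_inv invrN invr1 -exprnP sqrrN expr1n.
rewrite (eq_fsbigr (fun i : nat => i.+1%:R *:
  ((if n + i%:Z == -1 then opmode v (-2 - i%:Z) x else 0)
   - opmode v i%:Z (if -2 + n - i%:Z == -1 then x else 0)))); last first.
  move=> i _; rewrite binomz_opp2 scale1r add0r.
  by rewrite (opmode_vac (n + i%:Z) (opmode v (-2 - i%:Z) x)) (opmode_vac (-2 + n - i%:Z) x).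
case: (ltrgt0P n) => n0.
- rewrite (@fsum1 _ _ _ `|n - 1|%N) => [|i ni].
    rewrite ifF ?ifT ?sub0r ?scalerN; try lia.
    rewrite [_.+1%:R]pmulrn; congr (- (_%:~R *: opmode _ _ _)); lia.
  move/eqP: ni => ni.
  by rewrite ifF 1?ifF ?linear0 ?addr0 ?scaler0 //; apply/eqP; lia.
- rewrite (@fsum1 _ _ _ `|(n + 1)%R|%N) => [|i ni].
    rewrite ifT ?ifF ?linear0 ?addr0; try lia.
    by rewrite -scaleNr -mulrNz [_.+1%:R]pmulrn; congr (_%:~R *: opmode _ _ _); lia.
  move/eqP: ni => ni.
  by rewrite ifF 1?ifF ?linear0 ?addr0 ?scaler0 //; apply/eqP; lia.
- rewrite n0 scale0r oppr0 fsbig1 // => i _.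
  by rewrite ifF 1?ifF ?linear0 ?addr0 ?scaler0 //; apply/eqP; lia.
Qed.

End OppositeSpecial.

Section LinearFunctions.
Variables (K : numFieldType) (X Z : lmodType K) (f : X -> Z).
Hypothesis fl : linear f.

Lemma linear_fun0 : f 0 = 0.
Proof. by have := fl (-1) 0 0; rewrite !scaler0 addr0 scaleN1r addNr. Qed.

Lemma linear_funZ a x : f (a *: x) = a *: f x.
Proof. by rewrite -[a *: x]addr0 fl linear_fun0 addr0. Qed.

Lemma linear_funB x y : f (x - y) = f x - f y.
Proof. by rewrite addrC -scaleN1r fl scaleN1r addrC. Qed.

Lemma linear_fun_fsum (F : nat -> X) : eventually0 F ->
  f (\sum_(i \in [set: nat]) F i) = \sum_(i \in [set: nat]) f (F i).
Proof.
move=> [n Fn]; pose g : {linear X -> Z} := HB.pack f (GRing.isLinear.Build K X Z _ f fl).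
exact: (linear_fsum g Fn).
Qed.

End LinearFunctions.

Section DualModule.
Variables (K : numFieldType) (V : voa K) (Z : lmodType K).
Local Notation Y := (@voa_Y K V).
Local Notation om := (voa_omega V).
Local Notation vac := (voa_vac V).
Local Notation ax := (voa_adjoint V).

Definition dual_act_fun (v : V) (n : int) (f : V -> Z) : V -> Z := fun x => f (opmode v n x).

Lemma dual_act_linear v n : linear (dual_act_fun v n).
Proof. by move=> a f g; apply/funext => x. Qed.

HB.instance Definition _ v n :=
  GRing.isLinear.Build K (V -> Z) (V -> Z) _ (dual_act_fun v n) (dual_act_linear v n).

Definition dual_act v n : {linear (V -> Z) -> (V -> Z)} := dual_act_fun v n.

Definition truncated (f : V -> Z) : Prop := linear f /\
  forall v, exists N : int, forall n : int, N <= n -> forall x, f (opmode v n x) = 0.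

Lemma truncated_subspace : subspace truncated.
Proof.
split.
  split=> [a x y|v]; last by exists 0.
  by rewrite -[RHS]/(a *: 0 + 0) scaler0 addr0.
move=> a f g [fl ft] [gl gt]; split=> [b x y|v].
  rewrite -[LHS]/(a *: f (b *: x + y) + g (b *: x + y)) fl gl.
  by rewrite !scalerDr !scalerA mulrC addrACA.
have [N NP] := ft v; have [N' NP'] := gt v; exists (Num.max N N') => n.
rewrite ge_max => /andP[Nn N'n] x.
by rewrite -[LHS]/(a *: f (opmode v n x) + g (opmode v n x)) NP // NP' // scaler0 addr0.
Qed.

Lemma dual_commutator u v (m n : int) (f : V -> Z) : linear f ->
  dual_act v n (dual_act u m f) - dual_act u m (dual_act v n f)
  = \sum_(i \in [set: nat]) binomz K n i *: dual_act (Y v i%:Z u) (n + m - i%:Z) f.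
Proof.
move=> fl; have f0 := linear_fun0 fl.
have [N NP] := wm_truncation_nat ax v 0 u.
apply/funext => x; rewrite fsum_fun; last first.
  exists N => i /NP; rewrite add0r => ->; apply/funext => y.
  by rewrite -[LHS]/(_ *: f (opmode 0 _ y)) opmode0 f0 scaler0.
have := opmode_borcherds v u x n 0 m; rewrite /opmode_borcherds_l /opmode_borcherds_r.
rewrite [RHS](@fsum1 _ _ _ 0%N); last by case=> // i _; rewrite binomz0S mulr0 scale0r.
rewrite binomz0 expr0 mulr1 expr0z !scale1r !addr0 !add0r ?subr0 => /(congr1 f).
rewrite (linear_fun_fsum fl); last first.
  by exists N => i /NP; rewrite add0r => ->; rewrite opmode0 scaler0.
have fB := linear_funB fl.
have fZ := linear_funZ fl.
rewrite fB => E; rewrite -[LHS]/(f (opmode u m (opmode v n x)) - f (opmode v n (opmode u m x))) -E.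
by apply: eq_fsbigr => i _; rewrite fZ add0r.
Qed.

Lemma dual_associativity u v (m n : int) (f : V -> Z) : truncated f ->
  dual_act (Y v n u) m f = \sum_(i \in [set: nat]) ((-1) ^+ i * binomz K n i) *:
    (dual_act v (n - i%:Z) (dual_act u (m + i%:Z) f)
     - ((-1) ^ n : K) *: dual_act u (n + m - i%:Z) (dual_act v i%:Z f)).
Proof.
move=> [fl ft]; have f0 := linear_fun0 fl.
have fB := linear_funB fl.
have fZ := linear_funZ fl.
apply/funext => x; rewrite fsum_fun; last first.
  apply: eventually0Z; have [N NP] := ft u; have [N' NP'] := ft v.
  exists (`|N - m|%N + `|N'|%N)%N => i Ni; apply/funext => y.
  rewrite -[LHS]/(f (opmode u (m + i%:Z) (opmode v (n - i%:Z) y))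
    - ((-1) ^ n : K) *: f (opmode v i%:Z (opmode u (n + m - i%:Z) y))).
  by rewrite NP ?NP' ?scaler0 ?subr0 //; lia.
have := opmode_borcherds v u x 0 n m; rewrite /opmode_borcherds_l /opmode_borcherds_r.
rewrite [LHS](@fsum1 _ _ _ 0%N); last by case=> // i _; rewrite binomz0S scale0r.
rewrite binomz0 scale1r addr0 add0r subr0 => /(congr1 f).
rewrite [X in _ = X -> _](linear_fun_fsum fl); last first.
  apply: eventually0Z; under [X in eventually0 X]funext do rewrite -scaleNr.
  apply: eventually0D.
    by have [N NP] := opmode_supp v n x; exists N => i /NP; rewrite add0r => ->; rewrite linear0.
  apply: eventually0Z.
  by have [N NP] := opmode_supp u (n + m) x; exists N => i /NP ->; rewrite linear0.
move=> E; rewrite -[LHS]/(f (opmode (Y v n u) m x)) E.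
by apply: eq_fsbigr => i _; rewrite fZ fB fZ !add0r.
Qed.

(** The commutator formula moves the mode u(m), m large, past v(n) up to finitely
    many modes of vectors u(i) v, whose indices also grow with m. *)
Lemma truncated_stable v n f : truncated f -> truncated (dual_act v n f).
Proof.
move=> [fl ft]; split=> [a x y|u].
  by rewrite -[LHS]/(f (opmode v n (a *: x + y))) linearP fl.
have [I IP] := wm_truncation_nat ax u 0 v; have [Nu NuP] := ft u.
have /choice[g gP] i := ft (Y u i%:Z v).
pose N := (\max_(i < I) `|g i|%N + I + `|n|%N + `|Nu|%N)%N.
exists N%:Z => m Nm x.
have := congr1 (fun h : V -> Z => h x) (dual_commutator v u n m fl).
rewrite fsum_fun; last first.
  exists I => i /IP; rewrite add0r => ->; apply/funext => y.
  rewrite -[LHS]/(_ *: f (opmode 0 _ y)) opmode0.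
  by rewrite (linear_fun0 fl) scaler0.
rewrite -[LHS]/(f (opmode v n (opmode u m x)) - f (opmode u m (opmode v n x))).
rewrite (NuP m) ?subr0; last by rewrite /N in Nm; lia.
move=> E; rewrite -[LHS]/(f (opmode v n (opmode u m x))) E fsbig1 // => i _.
rewrite -[LHS]/(_ *: f (opmode (Y u i%:Z v) (m + n - i%:Z) x)).
have [Ii|iI] := leqP I i.
  have := IP i Ii; rewrite add0r => ->; rewrite opmode0.
  by rewrite (linear_fun0 fl) scaler0.
rewrite gP ?scaler0 //.
have : (`|g i| <= \max_(i < I) `|g i|)%N by exact: (@leq_bigmax _ _ (Ordinal iI)).
by rewrite /N in Nm; lia.
Qed.

Lemma dual_linear (a : K) (u v : V) n (f : V -> Z) : linear f ->
  dual_act (a *: u + v) n f = a *: dual_act u n f + dual_act v n f.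
Proof.
by move=> fl; apply/funext => x; rewrite -[LHS]/(f (opmode (a *: u + v) n x)) opmode_left fl.
Qed.

Lemma dual_truncation v f : truncated f ->
  exists N : int, forall n : int, N <= n -> dual_act v n f = 0.
Proof.
by move=> [fl ft]; have [N NP] := ft v; exists N => n Nn; apply/funext; exact: NP.
Qed.

Lemma dual_vacuum (n : int) (f : V -> Z) : linear f ->
  dual_act vac n f = if n == -1 then f else 0.
Proof.
move=> fl; apply/funext => x; rewrite -[LHS]/(f (opmode vac n x)) opmode_vac.
case: ifP => // _; exact: linear_fun0.
Qed.

Lemma dual_Virasoro (m n : int) (f : V -> Z) : linear f ->
  dual_act om (m + 1) (dual_act om (n + 1) f) - dual_act om (n + 1) (dual_act om (m + 1) f)
  = (m - n)%:~R *: dual_act om (m + n + 1) f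
    + (if m + n == 0 then ((m ^+ 3 - m)%:~R / 12%:R * voa_charge V) *: f else 0).
Proof.
move=> fl; apply/funext => x.
have f0 := linear_fun0 fl.
have fB := linear_funB fl.
rewrite -[LHS]/(f (opmode om (n + 1) (opmode om (m + 1) x))
  - f (opmode om (m + 1) (opmode om (n + 1) x))) -fB !opmode_omega.
have := wm_Virasoro ax (- n) (- m) x.
have -> : - n + 1 = 2 - (n + 1) by lia.
have -> : - m + 1 = 2 - (m + 1) by lia.
have -> : - n - m + 1 = 2 - (m + n + 1) by lia.
have -> : - n - - m = m - n by lia.
move=> ->; rewrite fl -opmode_omega -[RHS]/(_ *: f (opmode om (m + n + 1) x) +
  (if m + n == 0 then _ *: f else 0) x); congr (_ + _).
have [mn|mn] := eqVneq (m + n) 0; last by rewrite ifF ?f0 //; apply/eqP; lia.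
rewrite ifT; last by apply/eqP; lia.
rewrite -[_ *: x]addr0 fl f0 addr0 -[RHS]/(_ *: f x).
by have -> : - n = m by lia.
Qed.

Lemma dual_derivative v (n : int) (f : V -> Z) : linear f ->
  dual_act (Y om 0 v) n f = - (n%:~R *: dual_act v (n - 1) f).
Proof.
move=> fl; apply/funext => x.
rewrite -[LHS]/(f (opmode (Y om 0 v) n x)) opmode_derivative.
have f0 := linear_fun0 fl.
by rewrite -scaleNr -[_ *: _]addr0 fl f0 addr0 scaleNr.
Qed.

(** The contragredient of V, taken inside the full space of linear maps V -> Z and
    not only inside the sum of the duals of the V_n.  Values in an arbitrary space Z
    make the projection V -> V / C2(V) an element. *)
Definition dual_module : weak_module V :=
  @sub_weak_module K V (V -> Z) dual_act truncated truncated_subspace truncated_stable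
    (fun a u v n f ft => @dual_linear a u v n f (proj1 ft)) dual_truncation
    (fun n f ft => @dual_vacuum n f (proj1 ft))
    (fun m n f ft => @dual_Virasoro m n f (proj1 ft))
    (fun v n f ft => @dual_derivative v n f (proj1 ft))
    (fun u v m n f ft => @dual_commutator u v m n f (proj1 ft)) dual_associativity.

Definition dual_eval (x : V) (f : sub_lmod truncated_subspace) : Z := (\val f : V -> Z) x.

Lemma dual_eval_linear x : linear (dual_eval x).
Proof.
move=> a f g; rewrite /dual_eval -[RHS]/((a *: (\val f : V -> Z) + \val g) x).
by congr (_ x); rewrite -[RHS]linearP.
Qed.

HB.instance Definition _ x :=
  GRing.isLinear.Build K (sub_lmod truncated_subspace) Z _ (dual_eval x) (dual_eval_linear x).

Lemma dual_eval_act x v n (f : dual_module) :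
  dual_eval x (wm_act dual_module v n f) = dual_eval (opmode v n x) f.
Proof. by []. Qed.

Lemma dual_evalZ a x (f : dual_module) : dual_eval (a *: x) f = a *: dual_eval x f.
Proof.
have [fl _] := asboolW (valP f).
exact: linear_funZ.
Qed.

End DualModule.

(** * C2-cofiniteness from the dual module *)

(** Roots are split off one at a time. *)
Lemma nat_not_root (K : numFieldType) (p : {poly K}) : p != 0 ->
  exists R, forall n, (R <= n)%N -> p.[n%:R] != 0.
Proof.
have [k] := ubnP (size p); elim: k p => // k IH p; rewrite ltnS => pk p0.
have [[n pn]|np] := pselect (exists n : nat, root p n%:R); last first.
  by exists 0%N => n _; apply/negP => pn; apply: np; exists n.
have /factor_theorem[q pE] := pn.
have q0 : q != 0 by apply: contraNneq p0 => q0; rewrite pE q0 mul0r.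
have [|R RP] := IH q _ q0.
  by apply: leq_trans pk; rewrite pE size_mul ?polyXsubC_eq0 // size_XsubC addn2.
exists (maxn R n.+1) => m; rewrite geq_max => /andP[Rm nm].
rewrite pE hornerM mulf_neq0 ?RP // hornerXsubC subr_eq0 eqr_nat.
by rewrite gtn_eqF.
Qed.

Section C2Criterion.
Variables (K : numFieldType) (V : voa K).
Local Notation Y := (@voa_Y K V).
Local Notation om := (voa_omega V).
Local Notation vac := (voa_vac V).
Local Notation ax := (voa_adjoint V).
Local Notation grade := (@voa_grade K V).
Local Notation C2V := (@C2 K V).

Lemma C2_subspace : subspace C2V.
Proof. exact: linear_span_subspace. Qed.

(** The identity (n - 1) a(-n) = (L(-1) a)(-n + 1) reduces n to 2. *)
Lemma C2_mode a (n : int) b : n <= -2 -> C2V (Y a n b).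
Proof.
move=> n2; have -> : n = - `|n|%N%:Z by lia.
have : (2 <= `|n|)%N by lia.
elim: {n n2} `|n|%N a => // -[|[|k]] // IH a _.
  by apply: sub_linear_span; exists a, b.
have k0 : k.+2%:R != 0 :> K by rewrite pnatr_eq0.
have -> : Y a (- k.+3%:Z) b = k.+2%:R^-1 *: Y (Y om 0 a) (- k.+2%:Z) b.
  rewrite (wm_derivative ax) -scaleNr scalerA mulrNz opprK -pmulrn mulVf //.
  by rewrite scale1r; congr (Y _ _ _); lia.
by refine (subspaceZ _ C2_subspace _); apply: IH.
Qed.

(** For n large the opposite mode v(n) is a combination of modes x(k) with k <= -2,
    whose values lie in C2(V). *)
Lemma C2_proj_truncated : truncated (quot_proj C2_subspace).
Proof.
split; first exact: quot_proj_linear.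
apply: homogeneous_ind => [|r v vr].
  split; first by exists 0 => n _ x; rewrite opmode0; apply/quot_proj_eq0; case: C2_subspace.
  move=> a u v [N NP] [N' NP']; exists (Num.max N N') => n.
  rewrite ge_max => /andP[Nn N'n] x.
  by rewrite opmode_left quot_proj_linear NP // NP' // scaler0 addr0.
exists (2 * r) => n rn x; apply/quot_proj_eq0.
have [N NP] := div_L1_supp v; rewrite (opmode_homogeneous _ _ vr NP).
refine (subspaceZ _ C2_subspace _); refine (@subspace_sum _ _ _ _ _ _ _ C2_subspace _) => j _.
by apply: C2_mode; lia.
Qed.

Definition C2_proj : dual_module V (quot_lmod C2_subspace) :=
  Sub (quot_proj C2_subspace) (asboolT C2_proj_truncated).

Lemma C2_proj_eq0 (v : V) : dual_eval v C2_proj = 0 -> C2V v.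
Proof. by rewrite /dual_eval SubK => /quot_proj_eq0. Qed.

(** The finitely many V_n with n < R span V modulo C2(V). *)
Lemma C2_cofinite_of_grades (R : nat) :
  (forall n, (R <= n)%N -> grade n `<=` C2V) -> C2_cofinite V.
Proof.
move=> RP; have /choice[s sP] m := @voa_finite_dim K V m.
pose t := flatten [seq s m | m <- iota 0 R]; exists t.
have sT := linear_span_subspace [set` t].
apply: homogeneous_ind.
  split; first by exists 0; [case: sT | rewrite subr0; case: C2_subspace].
  move=> a u v [u' Tu' Cu'] [v' Tv' Cv']; exists (a *: u' + v').
    by case: sT => _; apply.
  rewrite opprD addrACA -scalerBr; case: C2_subspace => _; exact.
move=> r v vr; have [->|v0] := eqVneq v 0.
  by exists 0; [case: sT | rewrite subr0; case: C2_subspace].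
have [n _ vn] := homogeneous_grade vr v0; have [Rn|nR] := leqP R n.
  by exists 0; [case: sT | rewrite subr0; apply: (RP n)].
exists v; last by rewrite subrr; case: C2_subspace.
move: vn; rewrite sP; apply: linear_span_mono => x /= xs.
by apply/flattenP; exists (s n) => //; apply: map_f; rewrite mem_iota.
Qed.

(** The operator v(2r - 1), for v of weight r, lowers degrees by r, so it kills a
    vector with components in degrees less than r only.  Applied to C2_proj and
    evaluated at the vacuum, it gives the class of v up to sign: the terms with
    L(1)^j v, j > 0, lie in C2(V). *)
Lemma C2_cofinite_of_N_graded :
  (exists W : nat -> set (dual_module V (quot_lmod C2_subspace)),
     N_grading (dual_module V (quot_lmod C2_subspace)) W) -> C2_cofinite V.
Proof.
move=> [W [dW gW]]; have [s us cs] := component_supp dW C2_proj.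
apply: (@C2_cofinite_of_grades (\max_(n <- s) n).+1) => r sr v vr.
have : wm_act (dual_module V (quot_lmod C2_subspace)) v (2 * r%:Z - 1) C2_proj = 0.
  rewrite (component_sum dW C2_proj) (fsum_seq us cs) linear_sum big_seq big1 // => n ns.
  have := gW r n (2 * r%:Z - 1) v _ vr (component_in dW C2_proj n).
  have nr : (n < r)%N by apply: leq_trans sr; rewrite ltnS (leq_bigmax_seq (F := id)).
  have -> : n%:Z + r%:Z - (2 * r%:Z - 1) - 1 = Negz (r - n).-1 by rewrite NegzE; lia.
  by [].
move=> /(congr1 (dual_eval vac)); rewrite linear0 dual_eval_act => /C2_proj_eq0.
have vr' := grade_homogeneous vr; have [N NP] := div_L1_supp v.
have NP' j : (N.+1 <= j)%N -> div_L1 j v = 0 by move=> /ltnW; apply: NP.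
rewrite (opmode_homogeneous _ _ vr' NP') big_ord_recl div_L1_0.
have -> : Y v (2 * r%:Z - (2 * r%:Z - 1) - 2 - (ord0 : 'I_N.+1)%:Z) vac = v.
  have -> : 2 * r%:Z - (2 * r%:Z - 1) - 2 - (ord0 : 'I_N.+1)%:Z = -1 by rewrite /=; lia.
  by rewrite voa_creation.
move=> /(subspaceZ ((-1) ^ r%:Z) C2_subspace); rewrite scalerA signzz scale1r => H.
rewrite -[v](addrK (\sum_(i < N) Y (div_L1 (lift ord0 i) v)
  (2 * r%:Z - (2 * r%:Z - 1) - 2 - (lift ord0 i)%:Z) vac)).
refine (subspaceB C2_subspace H _); refine (@subspace_sum _ _ _ _ _ _ _ C2_subspace _) => j _.
by apply: C2_mode; rewrite lift0; lia.
Qed.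

(** On the dual module L(0) acts by f |-> f o L(0), so p(L(0)) multiplies C2_proj
    by p(n) on V_n. *)
Lemma C2_cofinite_of_eigen :
  direct_sum (gen_eigenspace (L_op (dual_module V (quot_lmod C2_subspace)) 0)) setT ->
  C2_cofinite V.
Proof.
set D := dual_module V _ => dE; pose L := wm_act D om (0 + 1).
have [s us cs] := component_supp dE C2_proj.
have [p p0 pf] := gen_eigenspaces_annihilated (f := L) s (component_in dE C2_proj).
rewrite -(fsum_seq us cs) -component_sum in pf.
have [R RP] := nat_not_root p0; apply: (@C2_cofinite_of_grades R) => n Rn v vn.
have LE i (g : D) : dual_eval v (iter i L g) = n%:R ^+ i *: dual_eval v g.
  elim: i => [|i IH]; first by rewrite expr0 scale1r.
  rewrite iterS dual_eval_act opmode_omega.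
  have -> : 2 - (0 + 1) = 1 :> int by [].
  by rewrite (voa_L0 vn) dual_evalZ IH scalerA exprS.
have : p.[n%:R] *: dual_eval v C2_proj = 0.
  move: pf => /(congr1 (dual_eval v)); rewrite /poly_act linear_sum linear0 => <-.
  rewrite horner_coef scaler_suml; apply: eq_bigr => i _.
  by rewrite linearZ /= -scalerA -LE.
move=> /eqP; rewrite scaler_eq0 (negPf (RP n Rn)) /= => /eqP.
exact: C2_proj_eq0.
Qed.

End C2Criterion.

(** * A spanning set of words *)

Section Generators.
Variables (K : numFieldType) (V : voa K).
Local Notation Y := (@voa_Y K V).
Local Notation grade := (@voa_grade K V).
Local Notation C2V := (@C2 K V).
Local Notation dV := (voa_direct_sum V).

(** The induction principle that C2-cofiniteness provides: modulo vectors
    a(-2)c, which have smaller total weight, finitely many homogeneous vectors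
    span V. *)
Definition generates (B : seq (nat * V)) := forall n v (U : set V), grade n v ->
  subspace U -> (forall b, (n, b) \in B -> U b) ->
  (forall p q a c, grade p a -> grade q c -> (p + q).+1 = n -> U (Y a (-2) c)) -> U v.

Lemma component_subspace n (U : set V) : subspace U ->
  subspace [set v | U (component dV v n)].
Proof.
move=> [U0 UD]; split=> [|a u v]; rewrite /= ?component0 // componentP.
exact: UD.
Qed.

Lemma C2_cofinite_generators : C2_cofinite V -> exists2 B : seq (nat * V),
  forall b, b \in B -> grade b.1 b.2 & generates B.
Proof.
move=> [s sP]; have /choice[N NP] := @component_bound K V.
pose B := [seq (n, component dV v n) | v <- s, n <- iota 0 (N v)].
exists B => [b|n v U vn sU UB UC].
  by move=> /allpairsPdep[v [n [_ _ ->]]]; apply: component_in.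
have [u su Cu] := sP v; have U0 : U 0 by case: sU.
have -> : v = component dV u n + component dV (v - u) n.
  rewrite -[component dV u n]scale1r -componentP scale1r addrC subrK.
  by rewrite (component_id dV _ vn) eqxx.
apply: subspaceD => //.
  apply: (linear_span_min (component_subspace n sU) _ su) => b /= bs.
  have [Nn|nN] := leqP (N b) n; first by rewrite NP.
  apply: UB; apply/allpairsPdep; exists b, n; split=> //.
  by rewrite mem_iota add0n.
apply: (linear_span_min (component_subspace n sU) _ Cu) => _ /= [a [b ->]].
move: a; apply: homogeneous_ind => [|p a ap].
  split=> [|c a a' Ua Ua']; first by rewrite /= (wm_act0 (voa_adjoint V)) component0.
  rewrite /= (wm_linear (voa_adjoint V)) componentP.
  by case: sU => _; apply.
move: b; apply: homogeneous_ind => [|q b bq].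
  split=> [|c b b' Ub Ub']; first by rewrite /= linear0 component0.
  by rewrite /= linearP componentP; case: sU => _; apply.
have [->|a0] := eqVneq a 0; first by rewrite (wm_act0 (voa_adjoint V)) component0.
have [->|b0] := eqVneq b 0; first by rewrite linear0 component0.
have [p' pE ap'] := homogeneous_grade ap a0; have [q' qE bq'] := homogeneous_grade bq b0.
have abn : grade (p' + q').+1 (Y a (-2) b).
  apply/homogeneous_nat; have := homogeneous_Y (-2) ap bq.
  by congr (homogeneous _ _); lia.
rewrite (component_id dV _ abn); case: eqP => // nE.
exact: (UC p' q').
Qed.

End Generators.

Section Words.
Variables (K : numFieldType) (V : voa K).
Local Notation Y := (@voa_Y K V).
Local Notation om := (voa_omega V).
Local Notation vac := (voa_vac V).
Local Notation grade := (@voa_grade K V).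

(** A letter (r, v, n) stands for the operator v(n) with v of weight r. *)
Definition letter := (nat * V * int)%type.
Implicit Types (x y : letter) (s t : seq letter).

Definition valid s := forall x, x \in s -> grade x.1.1 x.1.2.
Definition weight s := (\sum_(x <- s) x.1.1)%N.
Definition degree s : int := \sum_(x <- s) (x.1.1%:Z - x.2 - 1).

Lemma valid_cons x s : valid (x :: s) <-> grade x.1.1 x.1.2 /\ valid s.
Proof.
split=> [H|[xg sv] y]; last by rewrite inE => /predU1P[->|/sv].
by split=> [|y ys]; apply: H; rewrite inE ?eqxx ?ys ?orbT.
Qed.

Lemma valid_cat s t : valid (s ++ t) <-> valid s /\ valid t.
Proof.
split=> [H|[sv tv] x]; last by rewrite mem_cat => /orP[/sv|/tv].
by split=> x xs; apply: H; rewrite mem_cat xs ?orbT.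
Qed.

Lemma weight_cons x s : weight (x :: s) = (x.1.1 + weight s)%N.
Proof. by rewrite /weight big_cons. Qed.
Lemma weight_cat s t : weight (s ++ t) = (weight s + weight t)%N.
Proof. by rewrite /weight big_cat. Qed.
Lemma degree_cons x s : degree (x :: s) = x.1.1%:Z - x.2 - 1 + degree s.
Proof. by rewrite /degree big_cons. Qed.
Lemma degree_cat s t : degree (s ++ t) = degree s + degree t.
Proof. by rewrite /degree big_cat. Qed.

Variables (M : lmodType K) (act : V -> int -> {linear M -> M}).
Hypothesis ax : weak_module_axioms Y vac om (voa_charge V) act.

Definition eval_word s (w : M) := foldr (fun x => act x.1.2 x.2) w s.

Lemma eval_word_cat s t w : eval_word (s ++ t) w = eval_word s (eval_word t w).
Proof. exact: foldr_cat. Qed.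

Lemma eval_word_linear s : linear (eval_word s).
Proof. by move=> a u v; elim: s => //= x s ->; rewrite linearP. Qed.

HB.instance Definition _ s :=
  GRing.isLinear.Build K M M _ (eval_word s) (eval_word_linear s).

Variables (B : seq (nat * V)) (w : M) (T : nat).
Hypothesis Bgrade : forall b, b \in B -> grade b.1 b.2.
Hypothesis Bgen : generates B.
Hypothesis BT : forall b (n : int), b \in B -> T%:Z < n -> act b.2 n w = 0.

Definition normal s := [/\ forall x, x \in s -> x.1 \in B,
  forall x, x \in s -> x.2 <= T%:Z & sorted (fun x y => x.2 < y.2) s].

Definition normal_span (d : int) : set M := linear_span
  [set u | exists2 s, normal s /\ degree s = d & u = eval_word s w].

Local Lemma normal_span_subspace d : subspace (normal_span d).
Proof. exact: linear_span_subspace. Qed.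

Section Step.
Variables (d : int) (N l : nat).
Local Notation S := (normal_span d).
Hypothesis lower : forall s, valid s -> degree s = d ->
  (weight s < N)%N \/ weight s = N /\ (size s < l)%N -> S (eval_word s w).

(** The commutator of two letters is a combination of letters of smaller weight. *)
Lemma swap_letters s x y t : valid (s ++ x :: y :: t) ->
  degree (s ++ x :: y :: t) = d -> weight (s ++ x :: y :: t) = N ->
  S (eval_word (s ++ x :: y :: t) w) -> S (eval_word (s ++ y :: x :: t) w).
Proof.
move=> vs ds ws Sxy; have sS := normal_span_subspace d.
have -> : eval_word (s ++ y :: x :: t) w = eval_word (s ++ x :: y :: t) w
    - (eval_word (s ++ x :: y :: t) w - eval_word (s ++ y :: x :: t) w).
  by rewrite subKr.
apply: (subspaceB sS Sxy); rewrite !eval_word_cat -linearB /=.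
rewrite (wm_commutator ax); set u := eval_word t w.
have [I IP] := wm_truncation_nat (voa_adjoint V) x.1.2 0 y.1.2.
rewrite (linear_fsum (n := I) (eval_word s)); last first.
  by move=> i /IP; rewrite add0r => ->; rewrite (wm_act0 ax) scaler0.
apply: (subspace_fsum sS) => i; rewrite linearZ; apply: (subspaceZ _ sS).
move: vs => /valid_cat[vs /valid_cons[xg /valid_cons[yg vt]]].
have := homogeneous_Y i%:Z (grade_homogeneous xg) (grade_homogeneous yg).
have [->|v0] := eqVneq (Y x.1.2 i%:Z y.1.2) 0.
  by rewrite (wm_act0 ax) linear0; case: sS.
move=> /homogeneous_grade /(_ v0)[r rE vr].
move: ds ws; rewrite degree_cat weight_cat !degree_cons !weight_cons => ds ws.
have := @lower (s ++ (r, Y x.1.2 i%:Z y.1.2, x.2 + y.2 - i%:Z) :: t).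
rewrite degree_cat weight_cat degree_cons weight_cons eval_word_cat /=; apply.
- by apply/valid_cat; split=> //; apply/valid_cons.
- by lia.
- by left; lia.
Qed.

Lemma perm_letters s t : perm_eq s t -> valid s -> degree s = d -> weight s = N ->
  S (eval_word s w) -> S (eval_word t w).
Proof.
have move_letter (s1 t1 : seq letter) x t2 : valid (s1 ++ x :: t1 ++ t2) ->
    degree (s1 ++ x :: t1 ++ t2) = d -> weight (s1 ++ x :: t1 ++ t2) = N ->
    S (eval_word (s1 ++ x :: t1 ++ t2) w) -> S (eval_word (s1 ++ t1 ++ x :: t2) w).
  elim: t1 s1 => // y t1 IH s1 vs ds ws Ss.
  rewrite -[s1 ++ _]/(s1 ++ [:: y] ++ t1 ++ x :: t2) catA.
  have p : perm_eq (s1 ++ x :: y :: t1 ++ t2) (s1 ++ y :: x :: t1 ++ t2).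
    by rewrite perm_cat2l -[x :: _]/([:: x] ++ [:: y] ++ _) perm_catCA.
  apply: IH; rewrite -catA /=.
  - by move=> z; rewrite -(perm_mem p); apply: vs.
  - by rewrite -ds; apply/esym/perm_big.
  - by rewrite -ws; apply/esym/perm_big.
  - exact: swap_letters.
suff gen s1 : perm_eq s t -> valid (s1 ++ s) -> degree (s1 ++ s) = d ->
    weight (s1 ++ s) = N -> S (eval_word (s1 ++ s) w) -> S (eval_word (s1 ++ t) w).
  by move=> *; apply: (gen [::]).
elim: s t s1 => [|x s IH] t s1 st vs ds ws Ss.
  by move: st; rewrite perm_sym => /perm_nilP ->.
have xt : x \in t by rewrite -(perm_mem st) inE eqxx.
case/splitPr: xt st => t1 t2 st0.
have st : perm_eq s (t1 ++ t2).
  rewrite -(perm_cons x); apply: perm_trans st0 _.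
  by rewrite perm_sym -[x :: _ ++ _]/([:: x] ++ t1 ++ t2) perm_catCA.
have p : perm_eq (s1 ++ x :: s) (s1 ++ x :: t1 ++ t2) by rewrite perm_cat2l perm_cons.
apply: move_letter.
- by move=> z; rewrite -(perm_mem p); apply: vs.
- by rewrite -ds; apply/esym/perm_big.
- by rewrite -ws; apply/esym/perm_big.
have := IH (t1 ++ t2) (rcons s1 x) st; rewrite !cat_rcons; exact.
Qed.

(** Among words of given size, weight and degree with modes at most T, gap_sum is
    constant and gap_sq is bounded; replacing two equal modes n, n by n - i, n + i
    increases gap_sq, so that this replacement terminates. *)
Definition gap_sum s : int := \sum_(x <- s) (T%:Z - x.2).
Definition gap_sq s : int := \sum_(x <- s) (T%:Z - x.2) ^+ 2.

Lemma gap_sum_ge0 s : (forall x, x \in s -> x.2 <= T%:Z) -> 0 <= gap_sum s.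
Proof.
move=> sT; rewrite /gap_sum big_seq; apply: sumr_ge0 => x xs.
by rewrite subr_ge0 sT.
Qed.

Lemma gap_sq_le s : (forall x, x \in s -> x.2 <= T%:Z) -> gap_sq s <= gap_sum s ^+ 2.
Proof.
elim: s => [|x s IH] sT; first by rewrite /gap_sq /gap_sum !big_nil.
have sT' y : y \in s -> y.2 <= T%:Z by move=> ys; apply: sT; rewrite inE ys orbT.
rewrite /gap_sq /gap_sum !big_cons -/(gap_sq s) -/(gap_sum s).
have := gap_sum_ge0 sT'; have := IH sT'; have := sT x; rewrite inE eqxx => /(_ isT).
move: (gap_sq s) (gap_sum s) x.2 => a b c; nia.
Qed.

Lemma subspace_fsum_exchange (U : set M) (F : nat -> M) i0 : subspace U ->
  eventually0 F -> U (\sum_(i \in [set: nat]) F i) ->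
  (forall i, i != i0 -> U (F i)) -> U (F i0).
Proof.
move=> sU F0 UF Ui; pose G i := if i == i0 then 0 else F i.
have G0 : eventually0 G by have [n nP] := F0; exists n => i /nP ni; rewrite /G ni if_same.
have -> : F i0 = \sum_(i \in [set: nat]) F i - \sum_(i \in [set: nat]) G i.
  rewrite -[X in _ - X]scale1r -scaleNr -fsumZ // -fsumD //; last exact: (eventually0Z (fun=> -1)).
  rewrite (@fsum1 _ _ _ i0) /G => [|i /negPf ->]; last by rewrite scaleN1r subrr.
  by rewrite eqxx scaler0 addr0.
apply: (subspaceB sU UF); apply: subspace_fsum => // i; rewrite /G.
by case: eqP => [_|/eqP /Ui //]; case: sU.
Qed.

(** Besides u(n) v(n), the expansion of (u(-1)v)(2n+1) only contains products of u
    and v with modes n - i and n + i, i <> 0, and (u(-1)v)(2n+1) is a single letter of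
    the same total weight. *)
Lemma collide_letters x y t : x.2 = y.2 -> valid (x :: y :: t) ->
  degree (x :: y :: t) = d -> weight (x :: y :: t) = N -> size (x :: y :: t) = l ->
  (forall x' y', x'.1 = x.1 -> y'.1 = y.1 -> x'.2 + y'.2 = x.2 + y.2 ->
     x'.2 != y'.2 -> S (eval_word (x' :: y' :: t) w)) ->
  S (eval_word (x :: y :: t) w).
Proof.
move=> xy vs ds ws ls H; have sS := normal_span_subspace d.
move: (vs) => /valid_cons[xg /valid_cons[yg vt]].
move: (ds) (ws); rewrite !degree_cons !weight_cons -xy => ds' ws'.
pose n := x.2; set u := eval_word t w.
pose A i := act x.1.2 (-1 - i%:Z) (act y.1.2 (2 * n + 1 + i%:Z) u).
pose C i := act y.1.2 (2 * n - i%:Z) (act x.1.2 i%:Z u).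
have H' (p q : int) : p + q = 2 * n -> p != n -> S (act x.1.2 p (act y.1.2 q u)).
  move=> pq pn; have := H (x.1, p) (y.1, q); apply=> //=.
    by rewrite -xy pq /n; lia.
  by apply: contraNneq pn => pq'; apply/eqP; lia.
have swap (p q : int) : p + q = 2 * n -> S (act x.1.2 p (act y.1.2 q u)) ->
    S (act y.1.2 q (act x.1.2 p u)).
  move=> pq; apply: (@swap_letters [::] (x.1, p) (y.1, q) t) => /=.
  - by apply/valid_cons; split=> //; apply/valid_cons.
  - by rewrite !degree_cons /=; rewrite /n in pq; lia.
  - by rewrite !weight_cons.
have swap' (p q : int) : p + q = 2 * n -> S (act y.1.2 q (act x.1.2 p u)) ->
    S (act x.1.2 p (act y.1.2 q u)).
  move=> pq; apply: (@swap_letters [::] (y.1, q) (x.1, p) t) => /=.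
  - by apply/valid_cons; split=> //; apply/valid_cons.
  - by rewrite !degree_cons /=; rewrite /n in pq; lia.
  - by rewrite !weight_cons /=; lia.
have A0 : eventually0 A.
  have [I IP] := wm_truncation_nat ax y.1.2 (2 * n + 1) u.
  by exists I => i /IP; rewrite /A => ->; rewrite linear0.
have C0 : eventually0 C.
  have [I IP] := wm_truncation_nat ax x.1.2 0 u.
  by exists I => i /IP; rewrite /C add0r => ->; rewrite linear0.
have Ssum : S (\sum_(i \in [set: nat]) (A i + C i)).
  have <- : act (Y x.1.2 (-1) y.1.2) (2 * n + 1) u
      = \sum_(i \in [set: nat]) (A i + C i).
    rewrite (wm_associativity ax); apply: eq_fsbigr => i _.
    have -> : (-1) ^+ i * binomz K (-1) i = 1.
      elim: {A C A0 C0} i => [|i IH]; first by rewrite binomz0 mulr1.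
      have i0 : i.+1%:R != 0 :> K by rewrite pnatr_eq0.
      apply: (mulfI i0); rewrite mulrCA binomz_recr mulrCA exprSr mulrN1 mulNr IH.
      have -> : (-1 - i%:Z)%:~R = - i.+1%:R :> K.
        by rewrite [i.+1%:R]pmulrn -mulrNz; congr (_%:~R); lia.
      by rewrite mulrNN mulr1.
    rewrite scale1r exprN1 invrN1 scaleN1r opprK /A /C.
    by congr (_ + act _ _ _); lia.
  apply: (@lower (((x.1.1 + y.1.1)%N, Y x.1.2 (-1) y.1.2, 2 * n + 1) :: t)).
  - apply/valid_cons; split=> //=; apply/homogeneous_nat.
    have := homogeneous_Y (-1) (grade_homogeneous xg) (grade_homogeneous yg).
    by congr (homogeneous _ _); lia.
  - by rewrite degree_cons /= /n; lia.
  - by right; rewrite weight_cons /= -ls; split=> //; lia.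
rewrite /= -/u -xy -/n.
have [n0|n0] := leP 0 n.
- have nE : n = `|n|%N by lia.
  have SAC : S (A `|n|%N + C `|n|%N).
    apply: (subspace_fsum_exchange sS _ Ssum) => [|i ni]; first exact: eventually0D.
    apply: (subspaceD sS); first by apply: H'; [lia | apply/eqP; lia].
    apply: swap; first by lia.
    by apply: H'; [lia | apply: contraNneq ni => ni; apply/eqP; lia].
  apply: swap'; first by lia.
  have -> : act y.1.2 n (act x.1.2 n u) = A `|n|%N + C `|n|%N - A `|n|%N.
    by rewrite addrAC subrr add0r /C -nE; congr (act _ _ _); lia.
  by apply: (subspaceB sS SAC); apply: H'; [lia | apply/eqP; lia].
- pose k := `|(n + 1)%R|%N; have kE : n = -1 - k%:Z by rewrite /k; lia.
  have SAC : S (A k + C k).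
    apply: (subspace_fsum_exchange sS _ Ssum) => [|i ni]; first exact: eventually0D.
    apply: (subspaceD sS).
      by apply: H'; [lia | apply: contraNneq ni => ni; apply/eqP; lia].
    by apply: swap; [lia|apply: H'; [lia | apply/eqP; lia]].
  have -> : act x.1.2 n (act y.1.2 n u) = A k + C k - C k.
    by rewrite addrK /A -kE; congr (act _ _ (act _ _ _)); lia.
  by apply: (subspaceB sS SAC); apply: swap; [lia|apply: H'; [lia | apply/eqP; lia]].
Qed.

Lemma gap_sq_collide x y x' y' t : x.2 = y.2 -> x'.2 + y'.2 = x.2 + y.2 ->
  x'.2 != y'.2 -> gap_sq (x :: y :: t) < gap_sq (x' :: y' :: t).
Proof.
move=> xy xy' /eqP ne; rewrite /gap_sq !big_cons !addrA ltrD2r -xy.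
rewrite -xy in xy'.
have -> : y'.2 = x.2 + x.2 - x'.2 by lia.
have {}ne : x'.2 != x.2 by apply/eqP; lia.
have : 0 < (x'.2 - x.2) ^+ 2 by rewrite exprn_even_gt0 //= subr_eq0.
move: (T%:Z) x.2 x'.2 => a b c; nia.
Qed.

Lemma same_mode_pair s : ~~ uniq (map snd s) -> exists x y t,
  perm_eq s (x :: y :: t) /\ x.2 = y.2.
Proof.
elim: s => //= x s IH; rewrite negb_and negbK => /orP[/mapP[y ys xy]|/IH].
  by exists x, y, (rem y s); rewrite perm_cons perm_to_rem.
move=> [y [z [t [st yz]]]]; exists y, z, (x :: t); split=> //.
rewrite -[y :: _]/([:: y; z] ++ [:: x] ++ t) perm_sym perm_catCA perm_sym.
by rewrite perm_cons.
Qed.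

Lemma perm_letters_sym s t : perm_eq s t -> valid s -> degree s = d -> weight s = N ->
  S (eval_word t w) -> S (eval_word s w).
Proof.
move=> st vs ds ws; have ts : perm_eq t s by rewrite perm_sym.
apply: (perm_letters ts) => [x||]; first by rewrite (perm_mem ts); apply: vs.
  by rewrite -ds; apply: perm_big.
by rewrite -ws; apply: perm_big.
Qed.

(** The large mode can be moved to the end of the word, where it kills w. *)
Lemma large_mode_word s x : (forall x, x \in s -> x.1 \in B) -> degree s = d ->
  weight s = N -> x \in s -> T%:Z < x.2 -> S (eval_word s w).
Proof.
move=> sB ds ws xs xT; apply: (@perm_letters_sym _ (rem x s ++ [:: x])) => //.
- by rewrite perm_sym perm_catC perm_sym perm_to_rem.
- by move=> y /sB /Bgrade.
by rewrite eval_word_cat /= BT ?sB // linear0; case: (normal_span_subspace d).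
Qed.

Lemma generator_words m s : (forall x, x \in s -> x.1 \in B) -> degree s = d ->
  weight s = N -> size s = l -> (forall x, x \in s -> x.2 <= T%:Z) ->
  gap_sum s ^+ 2 - gap_sq s < m%:Z -> S (eval_word s w).
Proof.
have sS := normal_span_subspace d.
elim: m s => [|m IH] s sB ds ws ls sT ms.
  by have := gap_sq_le sT; lia.
have vs : valid s by move=> x /sB /Bgrade.
have perm t : perm_eq s t -> S (eval_word t w) -> S (eval_word s w).
  by move=> st; apply: perm_letters_sym.
have [us|/same_mode_pair[x [y [t [st xy]]]]] := boolP (uniq (map snd s)).
  pose r : rel letter := fun x y => x.2 <= y.2.
  apply: (perm (sort r s)); first by rewrite perm_sym perm_sort.
  apply: sub_linear_span; exists (sort r s) => //; split; last first.
    by rewrite -ds; apply: perm_big; rewrite perm_sort.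
  split=> [x|x|]; rewrite ?mem_sort; [exact: sB|exact: sT|].
  have := sort_sorted (leT := r) (fun x y => le_total x.2 y.2) s.
  have : uniq (map snd (sort r s)) by rewrite (perm_uniq (perm_map snd (permEl (perm_sort r s)))).
  elim: (sort r s) => //= x [|y q] //= IHq /andP[xq uq] /andP[xy yq].
  rewrite IHq // andbT lt_neqAle [_ <= _]xy andbT.
  by move: xq; rewrite inE negb_or => /andP[].
apply: (perm _ st).
have st' : perm_eq (x :: y :: t) s by rewrite perm_sym.
apply: collide_letters => //.
- by move=> z; rewrite (perm_mem st'); apply: vs.
- by rewrite -ds; apply: perm_big.
- by rewrite -ws; apply: perm_big.
- by rewrite -ls; apply: perm_size.
move=> x' y' xx' yy' E ne.
have zB z : z \in x' :: y' :: t -> z.1 \in B.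
  rewrite !inE => /predU1P[->|/predU1P[->|zt]].
  - by rewrite xx'; apply: sB; rewrite (perm_mem st) inE eqxx.
  - by rewrite yy'; apply: sB; rewrite (perm_mem st) !inE eqxx orbT.
  - by apply: sB; rewrite (perm_mem st) !inE zt !orbT.
have zd : degree (x' :: y' :: t) = d.
  have <- : degree (x :: y :: t) = d by rewrite -ds; apply: perm_big.
  by rewrite !degree_cons xx' yy'; lia.
have zw : weight (x' :: y' :: t) = N.
  have <- : weight (x :: y :: t) = N by rewrite -ws; apply: perm_big.
  by rewrite !weight_cons xx' yy'.
have [/hasP[z zin zT]|/hasPn zT] := boolP (has (fun z => T%:Z < z.2) (x' :: y' :: t)).
  exact: large_mode_word zB zd zw zin zT.
apply: IH => //; first by rewrite -ls (perm_size st).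
  by move=> z /zT; rewrite -leNgt.
have -> : gap_sum (x' :: y' :: t) = gap_sum s.
  have -> : gap_sum s = gap_sum (x :: y :: t) by apply: perm_big.
  by rewrite /gap_sum !big_cons !addrA; congr (_ + _); lia.
have : gap_sq s = gap_sq (x :: y :: t) by apply: perm_big.
have := gap_sq_collide t xy E ne.
by move: (gap_sum s ^+ 2) (gap_sq s) ms (gap_sq _) (gap_sq _) => a b + c e; lia.
Qed.

(** Letters are replaced by generators from left to right; a letter (a(-2)c)(n)
    expands into pairs of letters of smaller total weight. *)
Lemma all_words_step s : valid s -> degree s = d -> weight s = N -> size s = l ->
  S (eval_word s w).
Proof.
have sS := normal_span_subspace d.
suff gen s1 s2 : (forall x, x \in s1 -> x.1 \in B) -> valid s2 ->
    degree (s1 ++ s2) = d -> weight (s1 ++ s2) = N -> size (s1 ++ s2) = l ->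
    S (eval_word (s1 ++ s2) w) by apply: (gen [::]).
elim: s2 s1 => [|[[r v] n] s2 IH] s1 s1B /[swap].
  rewrite cats0 => ds _ ws ls.
  have [/hasP[z zin zT]|/hasPn zT] := boolP (has (fun z => T%:Z < z.2) s1).
    exact: large_mode_word s1B ds ws zin zT.
  apply: (@generator_words `|gap_sum s1 ^+ 2 - gap_sq s1|.+1) => //; last by lia.
  by move=> z /zT; rewrite -leNgt.
move=> ds /valid_cons[/= vr vs2] ws ls.
pose U : set V := [set v | S (eval_word (s1 ++ (r, v, n) :: s2) w)].
have sU : subspace U.
  split=> [|a u u' Uu Uu']; rewrite /U /= eval_word_cat /=.
    by rewrite (wm_act0 ax) linear0; case: sS.
  rewrite (wm_linear ax) linearP; case: sS => _; apply.
    by move: Uu; rewrite /U /= eval_word_cat.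
  by move: Uu'; rewrite /U /= eval_word_cat.
have vs1 : valid s1 by move=> x /s1B /Bgrade.
apply: (Bgen vr sU) => [b bB|p q a c ap cq rE].
  rewrite /U /= -cat_rcons; apply: IH => //.
  - by move=> x; rewrite mem_rcons inE => /predU1P[->|/s1B].
  - by rewrite cat_rcons -ds !degree_cat !degree_cons.
  - by rewrite cat_rcons -ws !weight_cat !weight_cons.
  - by rewrite cat_rcons -ls !size_cat.
rewrite /U /= eval_word_cat /= (wm_associativity ax); set u := eval_word s2 w.
have [I1 IP1] := wm_truncation_nat ax c n u.
have [I2 IP2] := wm_truncation_nat ax a 0 u.
rewrite (linear_fsum (n := maxn I1 I2) (eval_word s1)); last first.
  move=> i; rewrite geq_max => /andP[/IP1 -> /IP2]; rewrite add0r => ->.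
  by rewrite !linear0 ?addr0 ?scaler0.
apply: (subspace_fsum sS) => i; rewrite linearZ; apply: (subspaceZ _ sS).
rewrite linearB linearZ /=; apply: (subspaceB sS); last apply: (subspaceZ _ sS).
- have := @lower (s1 ++ (p, a, -2 - i%:Z) :: (q, c, n + i%:Z) :: s2).
  rewrite eval_word_cat /=; apply.
  + by apply/valid_cat; split=> //; apply/valid_cons; split=> //; apply/valid_cons.
  + by move: ds; rewrite !degree_cat !degree_cons /=; lia.
  + by left; move: ws; rewrite !weight_cat !weight_cons /=; lia.
- have := @lower (s1 ++ (q, c, -2 + n - i%:Z) :: (p, a, i%:Z) :: s2).
  rewrite eval_word_cat /=; apply.
  + by apply/valid_cat; split=> //; apply/valid_cons; split=> //; apply/valid_cons.
  + by move: ds; rewrite !degree_cat !degree_cons /=; lia.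
  + by left; move: ws; rewrite !weight_cat !weight_cons /=; lia.
Qed.

End Step.

(** Induction on the weight and, for equal weight, on the size of the word. *)
Theorem words_normal_span s : valid s -> normal_span (degree s) (eval_word s w).
Proof.
move=> vs; move dE: (degree s) => d.
have [N] := ubnP (weight s); elim: N s vs dE => // N IHN s vs dE; rewrite ltnS => sN.
have [l] := ubnP (size s); elim: l s vs dE sN => // l IHl s vs dE sN; rewrite ltnS => sl.
apply: (@all_words_step d (weight s) (size s)) => // t vt td [tw|[tw tl]].
  by apply: IHN => //; apply: leq_trans sN.
by apply: IHl => //; [rewrite tw | apply: leq_trans sl].
Qed.

End Words.

(** * Finitely many words of each degree *)

Section Finiteness.
Variables (K : numFieldType) (V : voa K).
Local Notation Y := (@voa_Y K V).
Local Notation om := (voa_omega V).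
Local Notation vac := (voa_vac V).
Local Notation grade := (@voa_grade K V).
Implicit Types s t : seq (letter V).

(** Strictly increasing modes bounded by T are at most T, T - 1, T - 2, ..., so
    only few letters can have negative degree. *)
Lemma normal_bounds (B : seq (nat * V)) (T : nat) s : normal B T s ->
  (forall x t, s = x :: t -> (size t)%:Z <= T%:Z - x.2) /\
  (size s)%:Z ^+ 2 - (size s)%:Z - 2 * (T%:Z + 1) * (size s)%:Z <= 2 * degree s.
Proof.
elim: s => [|x s IH] [sB sT srt].
  by split=> //; rewrite /degree big_nil /=; lia.
have /IH[bs ds] : normal B T s.
  by split=> [y ys|y ys|]; [apply: sB|apply: sT|apply: path_sorted srt];
    rewrite inE ys orbT.
have bx : (size s)%:Z <= T%:Z - x.2.
  case: s srt bs {IH ds sB} sT => [|y s] srt bs sT.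
    by rewrite subr_ge0; apply: sT; rewrite inE.
  by have := bs y s erefl; move: srt => /= /andP[xy _]; move: xy; lia.
split=> [y t [<- <-] //|]; rewrite degree_cons /=.
move: ds bx; move: (degree s) (size s) (x.2) (x.1.1) => e n a r; nia.
Qed.

(** Completing the square in the bound of normal_bounds. *)
Lemma normal_degree_ge (B : seq (nat * V)) (T : nat) s : normal B T s ->
  - (T.+1 ^ 2)%N%:Z <= degree s.
Proof.
move=> /normal_bounds[_]; move: (degree s) (size s) => e n.
rewrite [(_ ^ 2)%N]/(T.+1 * T.+1)%N => en.
have h : 0 <= (n%:Z - T%:Z - 1) ^+ 2 - (n%:Z - T%:Z - 1).
  by move: (n%:Z - T%:Z - 1) => x; nia.
nia.
Qed.

Lemma normal_behead (B : seq (nat * V)) (T : nat) x s :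
  normal B T (x :: s) -> normal B T s.
Proof.
move=> [sB sT srt]; split=> [y ys|y ys|]; [apply: sB|apply: sT|].
- by rewrite inE ys orbT.
- by rewrite inE ys orbT.
- exact: path_sorted srt.
Qed.

Fixpoint words_upto (A : seq (letter V)) n : seq (seq (letter V)) :=
  if n is m.+1 then [::] :: [seq x :: s | x <- A, s <- words_upto A m] else [:: [::]].

Lemma mem_words_upto A n s : (size s <= n)%N -> (forall x, x \in s -> x \in A) ->
  s \in words_upto A n.
Proof.
elim: n s => [|n IH] [|x s] //= sn sA.
rewrite inE; apply/orP; right; apply: allpairs_f; first by apply: sA; rewrite inE eqxx.
by apply: IH => // y ys; apply: sA; rewrite inE ys orbT.
Qed.

Lemma normal_words_finite (B : seq (nat * V)) (T : nat) (d : int) :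
  exists ss : seq (seq (letter V)), forall s, normal B T s -> degree s = d -> s \in ss.
Proof.
pose k := (`|d| + T.+1 + T.+1 ^ 2).+1.
pose A : seq (letter V) := [seq (b, T%:Z - i%:Z) | b <- B, i <- iota 0 k].
exists (words_upto A k) => s sn sd.
have [bs ds] := normal_bounds sn; case: (sn) => sB sT srt.
case: s sn sd bs ds sB sT srt => [|x s] sn sd bs ds sB sT srt.
  exact: mem_words_upto.
have bx := bs x s erefl.
have xk : T%:Z - x.2 < k%:Z.
  have := normal_degree_ge (normal_behead sn); move: sd; rewrite degree_cons /k => <-.
  by move: (degree s) (x.2) (x.1.1) => e n a; rewrite -mulnn; nia.
have sx y : y \in s -> x.2 <= y.2.
  move=> ys; move: srt => /=; rewrite path_sortedE; last by move=> a b c; apply: lt_trans.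
  by move=> /andP[/allP /(_ _ ys) /ltW].
apply: mem_words_upto => [|y ys].
  by rewrite /=; move: bx xk; lia.
have yk : T%:Z - y.2 < k%:Z.
  move: ys; rewrite inE => /predU1P[-> //|/sx]; move: xk; lia.
have := sT y ys; case: y ys yk => b n yin /= nk nT.
rewrite (_ : n = T%:Z - `|T%:Z - n|%N%:Z); last by lia.
apply: (allpairs_f (fun b i => (b, T%:Z - i%:Z))); first exact: (sB _ yin).
by rewrite mem_iota add0n /=; lia.
Qed.

End Finiteness.

Section Cofinite.
Variables (K : numFieldType) (V : voa K).
Local Notation Y := (@voa_Y K V).
Local Notation om := (voa_omega V).
Local Notation vac := (voa_vac V).
Local Notation grade := (@voa_grade K V).
Hypothesis cofinite : C2_cofinite V.
Variables (M : lmodType K) (act : V -> int -> {linear M -> M}).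
Hypothesis ax : weak_module_axioms Y vac om (voa_charge V) act.

Lemma generator_truncation (B : seq (nat * V)) (w : M) : exists T : nat,
  forall b (n : int), b \in B -> T%:Z < n -> act b.2 n w = 0.
Proof.
elim: B => [|b B [T TP]]; first by exists 0%N.
have [N NP] := wm_truncation ax b.2 w; exists (maxn T `|N|) => c n.
rewrite inE => /predU1P[->|cB] Tn; first by apply: NP; lia.
by apply: TP => //; lia.
Qed.

Lemma words_finite_dim (w : M) (d : int) : exists t : seq M,
  forall s, valid s -> degree s = d -> linear_span [set` t] (eval_word act s w).
Proof.
have [B Bg Bgen] := C2_cofinite_generators cofinite.
have [T BT] := generator_truncation B w; have [ss ssP] := normal_words_finite B T d.
exists [seq eval_word act s w | s <- ss] => s vs ds.
have := words_normal_span ax Bg Bgen BT vs; rewrite ds.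
apply: linear_span_min; first exact: linear_span_subspace.
move=> _ [t [tn td] ->]; apply: sub_linear_span => /=.
by apply: map_f; apply: ssP.
Qed.

Lemma words_degree_ge (w : M) : exists D : int,
  forall s, valid s -> degree s < D -> eval_word act s w = 0.
Proof.
have [B Bg Bgen] := C2_cofinite_generators cofinite.
have [T BT] := generator_truncation B w.
exists (- (T.+1 ^ 2)%N%:Z) => s vs ds.
have := words_normal_span ax Bg Bgen BT vs.
have sub0 : subspace [set 0 : M].
  by split=> // a _ _ -> ->; rewrite scaler0 addr0.
apply: (linear_span_min sub0) => u [t [tn td] _].
by have := normal_degree_ge tn; rewrite td leNgt ds.
Qed.

(** L(0) is a letter of degree 0, and the words of degree 0 span a
    finite-dimensional space. *)
Lemma L0_annihilated (w : M) :
  exists2 p : {poly K}, p != 0 & poly_act (act om (0 + 1)) p w = 0.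
Proof.
have [t tP] := words_finite_dim w 0; apply: (@finite_orbit_annihilated _ _ _ t) => n.
pose s : seq (letter V) := nseq n (2%N, om, 1).
have -> : iter n (act om (0 + 1)) w = eval_word act s w.
  by rewrite {}/s; elim: n => //= n ->.
apply: tP; first by move=> x /nseqP[-> _]; apply: voa_omega_grade.
by rewrite /degree big1_seq // => x /nseqP[->].
Qed.

End Cofinite.

(** * Uniformly truncated families and bounds on eigenvalues *)

Section ProductModule.
Variables (K : numFieldType) (V : voa K) (M : weak_module V) (I : Type).
Local Notation Y := (@voa_Y K V).
Local Notation om := (voa_omega V).
Local Notation vac := (voa_vac V).
Local Notation act := (wm_act M).
Local Notation ax := (wm_axioms M).

Definition prod_act_fun (v : V) (n : int) (f : I -> M) : I -> M := fun i => act v n (f i).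

Lemma prod_act_linear v n : linear (prod_act_fun v n).
Proof. by move=> a f g; apply/funext => i; rewrite /prod_act_fun linearP. Qed.

HB.instance Definition _ v n :=
  GRing.isLinear.Build K (I -> M) (I -> M) _ (prod_act_fun v n) (prod_act_linear v n).

Definition prod_act v n : {linear (I -> M) -> (I -> M)} := prod_act_fun v n.

(** A product of weak modules satisfies the truncation condition only on families
    that are truncated uniformly. *)
Definition uniformly_truncated (f : I -> M) : Prop :=
  forall v, exists N : int, forall n : int, N <= n -> forall i, act v n (f i) = 0.

Lemma uniformly_truncated_subspace : subspace uniformly_truncated.
Proof.
split=> [v|a f g ft gt v]; first by exists 0 => n _ i; rewrite linear0.
have [N NP] := ft v; have [N' NP'] := gt v; exists (Num.max N N') => n.
rewrite ge_max => /andP[Nn N'n] i.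
by rewrite -[(_ + _) i]/(a *: f i + g i) linearP NP // NP' // scaler0 addr0.
Qed.

Lemma prod_commutator u v (m n : int) (f : I -> M) :
  prod_act v n (prod_act u m f) - prod_act u m (prod_act v n f)
  = \sum_(i \in [set: nat]) binomz K n i *: prod_act (Y v i%:Z u) (n + m - i%:Z) f.
Proof.
apply/funext => k; rewrite fsum_fun; first exact: (wm_commutator ax).
have [N NP] := wm_truncation_nat (voa_adjoint V) v 0 u; exists N => i /NP.
rewrite add0r => ->; apply/funext => j.
by rewrite -[LHS]/(_ *: act 0 _ (f j)) (wm_act0 ax) scaler0.
Qed.

Lemma prod_associativity u v (m n : int) (f : I -> M) : uniformly_truncated f ->
  prod_act (Y v n u) m f = \sum_(i \in [set: nat]) ((-1) ^+ i * binomz K n i) *: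
    (prod_act v (n - i%:Z) (prod_act u (m + i%:Z) f)
     - ((-1) ^ n : K) *: prod_act u (n + m - i%:Z) (prod_act v i%:Z f)).
Proof.
move=> ft; apply/funext => k; rewrite fsum_fun; first exact: (wm_associativity ax).
apply: eventually0Z; have [N NP] := ft u; have [N' NP'] := ft v.
exists (`|N - m|%N + `|N'|%N)%N => i Ni; apply/funext => j.
rewrite -[LHS]/(act v (n - i%:Z) (act u (m + i%:Z) (f j))
  - ((-1) ^ n : K) *: act u (n + m - i%:Z) (act v i%:Z (f j))).
by rewrite NP ?NP' ?linear0 ?addr0 //; lia.
Qed.

Lemma uniformly_truncated_stable v n f :
  uniformly_truncated f -> uniformly_truncated (prod_act v n f).
Proof.
move=> ft u; have [J JP] := wm_truncation_nat (voa_adjoint V) u 0 v.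
have [Nu NuP] := ft u; have /choice[g gP] i := ft (Y u i%:Z v).
exists (\max_(i < J) `|g i|%N + J + `|n|%N + `|Nu|%N)%N%:Z => m Nm k.
rewrite -[prod_act v n f k]/(act v n (f k)).
have := wm_commutator ax v u n m (f k); rewrite (NuP m) ?linear0 ?addr0; last by lia.
move=> ->; rewrite fsbig1 // => i _; have [Ji|iJ] := leqP J i.
  by have := JP i Ji; rewrite add0r => ->; rewrite (wm_act0 ax) scaler0.
rewrite gP ?scaler0 //.
have : (`|g i| <= \max_(i < J) `|g i|)%N by exact: (@leq_bigmax _ _ (Ordinal iJ)).
by lia.
Qed.

Lemma prod_linear (a : K) (u v : V) n (f : I -> M) :
  prod_act (a *: u + v) n f = a *: prod_act u n f + prod_act v n f.
Proof. by apply/funext => i; apply: (wm_linear ax). Qed.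

Lemma prod_truncation v f : uniformly_truncated f ->
  exists N : int, forall n : int, N <= n -> prod_act v n f = 0.
Proof.
by move=> /(_ v)[N NP]; exists N => n Nn; apply/funext => i; apply: NP.
Qed.

Lemma prod_vacuum (n : int) (f : I -> M) :
  prod_act vac n f = if n == -1 then f else 0.
Proof.
by apply/funext => i; rewrite -[LHS]/(act vac n (f i)) (wm_vacuum ax); case: ifP.
Qed.

Lemma prod_Virasoro (m n : int) (f : I -> M) :
  prod_act om (m + 1) (prod_act om (n + 1) f) - prod_act om (n + 1) (prod_act om (m + 1) f)
  = (m - n)%:~R *: prod_act om (m + n + 1) f
    + (if m + n == 0 then ((m ^+ 3 - m)%:~R / 12%:R * voa_charge V) *: f else 0).
Proof.
apply/funext => i; have := wm_Virasoro ax m n (f i).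
by case: ifP => _ E; rewrite -[RHS]E.
Qed.

Lemma prod_derivative v (n : int) (f : I -> M) :
  prod_act (Y om 0 v) n f = - (n%:~R *: prod_act v (n - 1) f).
Proof. by apply/funext => i; apply: (wm_derivative ax). Qed.

Definition prod_module : weak_module V :=
  @sub_weak_module K V (I -> M) prod_act uniformly_truncated
    uniformly_truncated_subspace uniformly_truncated_stable
    (fun a u v n f _ => prod_linear a u v n f) prod_truncation
    (fun n f _ => prod_vacuum n f) (fun m n f _ => prod_Virasoro m n f)
    (fun v n f _ => prod_derivative v n f)
    (fun u v m n f _ => prod_commutator u v m n f) prod_associativity.

Definition prod_eval (i : I) (f : sub_lmod uniformly_truncated_subspace) : M :=
  (\val f : I -> M) i.

Lemma prod_eval_linear i : linear (prod_eval i).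
Proof.
move=> a f g; rewrite /prod_eval -[RHS]/((a *: (\val f : I -> M) + \val g) i).
by congr (_ i); rewrite -[RHS]linearP.
Qed.

HB.instance Definition _ i := GRing.isLinear.Build K
  (sub_lmod uniformly_truncated_subspace) M _ (prod_eval i) (prod_eval_linear i).

Lemma prod_eval_act i v n (f : prod_module) :
  prod_eval i (wm_act prod_module v n f) = act v n (prod_eval i f).
Proof. by []. Qed.

(** The family is a single vector of the product module. *)
Lemma uniform_L0_annihilated (f : I -> M) : C2_cofinite V -> uniformly_truncated f ->
  exists2 p : {poly K}, p != 0 & forall i, poly_act (act om (0 + 1)) p (f i) = 0.
Proof.
move=> cof ft; pose F : prod_module := Sub f (asboolT ft).
have [p p0 pF] := L0_annihilated cof (wm_axioms prod_module) F.
exists p => // i; have fE : prod_eval i F = f i by rewrite /prod_eval SubK.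
have LE n : prod_eval i (iter n (wm_act prod_module om (0 + 1)) F)
    = iter n (act om (0 + 1)) (f i).
  by elim: n => //= n IH; rewrite prod_eval_act IH.
move: pF => /(congr1 (prod_eval i)); rewrite /poly_act linear_sum linear0 => pF.
apply: etrans pF.
by rewrite /poly_act; apply: eq_bigr => n _; rewrite linearZ /= -LE.
Qed.

End ProductModule.

Section Eigenvalues.
Variables (K : numFieldType) (V : voa K) (M : weak_module V).
Local Notation Y := (@voa_Y K V).
Local Notation om := (voa_omega V).
Local Notation grade := (@voa_grade K V).
Local Notation act := (wm_act M).
Local Notation ax := (wm_axioms M).
Local Notation E := (gen_eigenspace (act om (0 + 1))).

(** Since [L(0), v(n)] = (r - n - 1) v(n), the mode v(n) intertwines L(0) - a with
    L(0) - a - (r - n - 1). *)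
Lemma act_gen_eigenspace r v n a w : homogeneous r v -> E a w ->
  E (a + (r - n - 1)%:~R) (act v n w).
Proof.
move=> vr [N NP]; exists N => k Nk; pose d : K := (r - n - 1)%:~R.
suff -> : iter k (fun u => act om (0 + 1) u - (a + d) *: u) (act v n w)
    = act v n (iter k (fun u => act om (0 + 1) u - a *: u) w).
  by rewrite NP // linear0.
elim: k {Nk} => //= k ->; move: (iter _ _ _) => z.
rewrite [act v n (_ - _)]linearB [act v n (a *: z)]linearZ /= -/d.
rewrite (act_L0 ax n z vr) -/d scalerDl opprD [- _ - _]addrC addrA addrK.
by [].
Qed.

Lemma word_gen_eigenspace s a w : valid s -> E a w ->
  E (a + (degree s)%:~R) (eval_word act s w).
Proof.
elim: s => [|x s IH] vs wa; first by rewrite /degree big_nil addr0.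
move: vs => /valid_cons[xg vs]; rewrite degree_cons /= rmorphD /= [_ + (degree s)%:~R]addrC addrA.
by apply: act_gen_eigenspace; [apply: grade_homogeneous | apply: IH].
Qed.

Hypothesis cof : C2_cofinite V.

(** Degrees of words that do not kill w are bounded below; a word of minimal degree
    produces a vector that every letter of negative degree kills. *)
Lemma lowest_weight_vector w : w != 0 -> exists s : seq (letter V),
  [/\ valid s, degree s <= 0, eval_word act s w != 0 &
      forall r v (n : int), grade r v -> r%:Z <= n -> act v n (eval_word act s w) = 0].
Proof.
move=> w0; have [D DP] := words_degree_ge cof ax w.
pose P e := `[< exists s, [/\ valid s, degree s = D + e%:Z & eval_word act s w != 0] >].
have D0 : D <= 0.
  rewrite leNgt; apply/negP => D0; move/eqP: w0; apply.
  by apply: (DP [::]) => //; rewrite /degree big_nil.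
have P0 : P `|D|%N.
  by apply/asboolP; exists [::]; split=> //; rewrite /degree big_nil; lia.
have exP : exists e, P e by exists `|D|%N.
case: (ex_minnP exP) => e /asboolP[s [vs ds s0]] emin.
exists s; split=> //; first by have := emin _ P0; lia.
move=> r v n vr rn; apply/eqP; apply: contraT => vs0.
have vs' : valid ((r, v, n) :: s) by apply/valid_cons.
have dD : D <= degree ((r, v, n) :: s).
  by rewrite leNgt; apply/negP => /(DP _ vs') /eqP; apply/negP.
have /emin : P `|degree ((r, v, n) :: s) - D|%N.
  by apply/asboolP; exists ((r, v, n) :: s); split=> //; lia.
by move: dD; rewrite degree_cons /=; lia.
Qed.

(** Otherwise some family of lowest weight vectors has eigenvalues a - k with k
    unbounded; such a family is uniformly truncated, since v(n) with n >= wt v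
    kills all of its members, so one polynomial would annihilate all of it. *)
Lemma eigenvalues_bounded (a : K) : exists R : nat,
  forall k w, (R <= k)%N -> E (a - k%:R) w -> w = 0.
Proof.
apply/not_existsP => H.
have /choice[f fP] (R : nat) : exists kw : nat * M, [/\ (R <= kw.1)%N,
    E (a - kw.1%:R) kw.2, kw.2 != 0 &
    forall r v (n : int), grade r v -> r%:Z <= n -> act v n kw.2 = 0].
  have [k [w [Rk [kw /eqP w0]]]] : exists k w, (R <= k)%N /\ E (a - k%:R) w /\ w <> 0.
    apply: contrapT => no; apply: (H R) => k w Rk kw; apply: contrapT => w0.
    by apply: no; exists k, w.
  have [s [vs ds s0 sl]] := lowest_weight_vector w0.
  exists ((k + `|degree s|)%N, eval_word act s w); split=> //=.
    by apply: leq_trans Rk _; apply: leq_addr.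
  have := word_gen_eigenspace vs kw; congr (E _ _).
  have -> : degree s = - `|degree s|%N%:Z by lia.
  by rewrite abszN absz_nat natrD mulrNz opprD addrA -pmulrn.
have ft : uniformly_truncated (fun R => (f R).2).
  apply: homogeneous_ind => [|r v vr].
    split=> [|c u v [N NP] [N' NP']].
      by exists 0 => n _ i; rewrite (wm_act0 ax).
    exists (Num.max N N') => n; rewrite ge_max => /andP[Nn N'n] i.
    by rewrite (wm_linear ax) NP // NP' // scaler0 addr0.
  have [->|v0] := eqVneq v 0; first by exists 0 => n _ i; rewrite (wm_act0 ax).
  have [m mr vm] := homogeneous_grade vr v0; exists m => n mn i.
  by have [_ _ _ fl] := fP i; apply: (fl m).
have [p p0 pf] := uniform_L0_annihilated cof ft.
pose q := p \Po (a%:P - 'X).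
have q0 : q != 0.
  apply: contraNneq p0 => /(congr1 (fun q => q \Po (a%:P - 'X))).
  rewrite -comp_polyA comp_polyB comp_polyC comp_polyX opprB addrC subrK comp_polyXr.
  by rewrite comp_poly0 => ->.
have [R RP] := nat_not_root q0; have [Rk kw w0 _] := fP R.
have := gen_eigenspace_root p0 kw (pf R) w0; apply/negP.
by have := RP _ Rk; rewrite horner_comp !hornerE.
Qed.

End Eigenvalues.

(** * Gradings by height, and finite generation *)

Section Regrouping.
Variables (K : fieldType) (M : lmodType K) (I : choiceType) (U : I -> set M).
Hypothesis dU : direct_sum U setT.
Variable h : I -> nat.
Local Notation comp := (component dU).

(** The sum of the U i with h i = n, described by components. *)
Definition regroup (n : nat) : set M := [set w | forall i, comp w i != 0 -> h i = n].

Lemma regroup_in i u : U i u -> regroup (h i) u.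
Proof.
by move=> Uu j; rewrite (component_id dU _ Uu); case: (j =P i) => [->|]; rewrite ?eqxx.
Qed.

Lemma regroup_subspace n : subspace (regroup n).
Proof.
split=> [i|a u v nu nv i]; first by rewrite component0 eqxx.
rewrite componentP; have [u0|/nu //] := eqVneq (comp u i) 0.
by rewrite u0 scaler0 add0r; apply: nv.
Qed.

Lemma component_big (J : Type) (s : seq J) (F : J -> M) i :
  comp (\sum_(j <- s) F j) i = \sum_(j <- s) comp (F j) i.
Proof.
elim: s => [|j s IH]; first by rewrite !big_nil component0.
by rewrite !big_cons -[F j]scale1r componentP !scale1r IH.
Qed.

Lemma component_list w : exists2 s : seq I, w = \sum_(i <- s) comp w i &
  forall i, i \in s -> comp w i != 0.
Proof.
have [s us cs] := component_supp dU w; exists [seq i <- s | comp w i != 0].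
  rewrite {1}(component_sum dU w) (fsum_seq us cs) big_filter [RHS]big_mkcond /=.
  by apply: eq_bigr => i _; case: eqP.
by move=> i; rewrite mem_filter => /andP[].
Qed.

Lemma regroup_direct_sum : direct_sum regroup setT.
Proof.
apply: direct_sum_intro.
- exact: subspaceT.
- exact: regroup_subspace.
- by [].
- move=> w _; have [s sE _] := component_list w.
  exists [seq (h i, comp w i) | i <- s]; last by rewrite big_map.
  by move=> _ /mapP[i _ ->]; apply: regroup_in; apply: component_in.
move=> s f us fn f0 n ns; rewrite (component_sum dU (f n)) fsbig1 // => i _.
apply/eqP; apply: contraT => ci; have hi := fn n i ci.
have : comp (\sum_(k <- s) f k) i = 0 by rewrite f0 component0.
rewrite component_big (bigD1_seq n) //= big1 ?addr0 => [/eqP|k kn].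
  by rewrite (negPf ci).
by apply/eqP; apply: contraT => /(fn k); rewrite hi => nk; rewrite nk eqxx in kn.
Qed.

Lemma regroup_refined n : direct_sum (fun i => U i `&` regroup n) (regroup n).
Proof.
have sU i : subspace (U i) by case: dU.
apply: direct_sum_intro.
- exact: regroup_subspace.
- by move=> i; apply: subspaceI => //; exact: regroup_subspace.
- by move=> i u [].
- move=> w wn; have [s sE sn] := component_list w.
  exists [seq (i, comp w i) | i <- s]; last by rewrite big_map.
  move=> _ /mapP[i /sn /wn hi ->] /=; split; first exact: component_in.
  by rewrite -hi; apply: regroup_in; apply: component_in.
move=> s f us fU f0 i is_.
have : comp (\sum_(k <- s) f k) i = 0 by rewrite f0 component0.
rewrite component_big (bigD1_seq i) //= (component_id dU _ (fU i).1) eqxx.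
rewrite big1 ?addr0 // => k ki; rewrite (component_id dU _ (fU k).1).
by rewrite eq_sym (negPf ki).
Qed.

End Regrouping.

Section FiniteGeneration.
Variables (K : numFieldType) (V : voa K).

(** Vectors a(-2)c of weight n come from vectors a and c of smaller weight. *)
Lemma finitely_generated_of_C2_cofinite : C2_cofinite V -> finitely_generated V.
Proof.
move=> /C2_cofinite_generators[B Bg Bgen]; exists [seq b.2 | b <- B].
apply/seteqP; split=> // x _ U [[sU U1 UY] BU]; move: x.
apply: (homogeneous_ind sU) => r v vr.
have [->|v0] := eqVneq v 0; first by case: sU.
have [n _ vn] := homogeneous_grade vr v0; move: vn.
have [m] := ubnP n; elim: m n {vr v0} v => // m IH n v; rewrite ltnS => nm vn.
apply: (Bgen n v U vn sU) => [b bB|p q a c ap cq pq].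
  by apply: BU => /=; apply/mapP; exists (n, b).
by apply: UY; [apply: (IH p) ap | apply: (IH q) cq]; lia.
Qed.

End FiniteGeneration.

Section Cofinite.
Variables (K : numClosedFieldType) (V : voa K).
Local Notation om := (voa_omega V).
Hypothesis cof : C2_cofinite V.

Lemma eigen_direct_sum_of_C2_cofinite (M : weak_module V) :
  direct_sum (gen_eigenspace (L_op M 0)) setT.
Proof.
pose f := wm_act M om (0 + 1).
apply: (@direct_sum_intro _ _ _ (gen_eigenspace f)).
- exact: subspaceT.
- exact: gen_eigenspace_subspace.
- by [].
- move=> w _; have [p p0 pw] := L0_annihilated cof (wm_axioms M) w.
  exact: annihilated_decomposition p0 pw.
- exact: gen_eigenspaces_free.
Qed.

Variable M : weak_module V.
Local Notation E := (gen_eigenspace (L_op M 0)).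

Lemma height_exists (a : K) : exists k : nat, (exists2 w, E a w & w != 0) ->
  (exists2 w, E (a - k%:R) w & w != 0) /\
  forall k' w, (k < k')%N -> E (a - k'%:R) w -> w = 0.
Proof.
have [[w0 aw w00]|no] := pselect (exists2 w, E a w & w != 0); last by exists 0%N.
have [R RP] := eigenvalues_bounded M cof a.
pose P k := `[< exists2 w, E (a - k%:R) w & w != 0 >].
have P0 : exists k, P k by exists 0%N; apply/asboolP; exists w0; rewrite ?subr0.
have PR k : P k -> (k <= R)%N.
  move=> /asboolP[w kw w1]; rewrite leqNgt; apply/negP => /ltnW kR.
  by move: w1; rewrite (RP k w kR kw) eqxx.
case: (ex_maxnP P0 PR) => k /asboolP Pk kmax; exists k => _; split=> // k' w kk' kw.
apply/eqP; apply: contraTT kk' => w1; rewrite -leqNgt; apply: kmax.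
by apply/asboolP; exists w.
Qed.

(** The eigenvalues in a class of K / Z are bounded below; the degree of a
    generalized eigenvector is the height of its eigenvalue above the lowest one in
    the same class. *)
Lemma N_graded_of_C2_cofinite : exists2 W : nat -> set M, N_grading M W &
  forall n, direct_sum (fun a => E a `&` W n) (W n).
Proof.
have dE := eigen_direct_sum_of_C2_cofinite M.
have /choice[h hP] := height_exists.
exists (regroup dE h); last exact: regroup_refined.
split; first exact: regroup_direct_sum.
move=> r n m v w vr wn; set k := _ - 1.
have sG : subspace (int_grade (regroup dE h) k).
  case: k => k; first exact: regroup_subspace.
  by split=> // a u u' -> ->; rewrite scaler0 addr0.
have [s sE sn] := component_list dE w; rewrite sE linear_sum.
apply: (subspace_sum_seq sG) => a /sn ca; have ha := wn a ca.
set c := component dE w a; have cE : E a c by apply: component_in.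
have [->|y0] := eqVneq (wm_act M v m c) 0; first by case: sG.
pose d := r%:Z - m - 1; have yE : E (a + d%:~R) (wm_act M v m c).
  exact: act_gen_eigenspace (grade_homogeneous vr) cE.
have [[w1 w1E w10] low] : (exists2 w, E (a - n%:R) w & w != 0) /\
    forall k' w, (n < k')%N -> E (a - k'%:R) w -> w = 0.
  by rewrite -ha; apply: hP; exists c.
have kE : k = n%:Z + d by rewrite /k /d; lia.
have k0 : 0 <= k.
  rewrite leNgt; apply/negP => kn; move/eqP: y0; apply.
  apply: (low `|d|%N); first by lia.
  have -> : a - `|d|%N%:R = a + d%:~R.
    have dN : d = - `|d|%N%:Z by lia.
    by rewrite [in RHS]dN mulrNz -pmulrn.
  exact: yE.
have hk : h (a + d%:~R) = `|k|%N.
  have [|[w2 w2E w20] low2] := hP (a + d%:~R); first by exists (wm_act M v m c).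
  have E1 : a + d%:~R - `|k|%N%:R = a - n%:R.
    have -> : `|k|%N%:R = n%:R + d%:~R :> K.
      by rewrite [`|k|%N%:R]pmulrn [n%:R]pmulrn -rmorphD /= -kE gez0_abs.
    by rewrite opprD addrACA subrr addr0.
  apply/eqP; rewrite eqn_leq; apply/andP; split.
    rewrite leqNgt; apply/negP => lt; move/eqP: w20; apply.
    pose b := a + d%:~R; pose j := (n + (h b - `|k|%N))%N.
    apply: (low j); first by rewrite /j; move: lt; rewrite /b; lia.
    have -> : a - j%:R = b - (h b)%:R; last exact: w2E.
    by rewrite -[h b in RHS](subnKC (ltnW lt)) natrD opprD addrA E1 /j natrD opprD addrA.
  rewrite leqNgt; apply/negP => lt; move/eqP: w10; apply.
  by apply: (low2 _ _ lt); rewrite E1.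
have -> : k = `|k|%N%:Z by lia.
by rewrite /= -hk; apply: regroup_in.
Qed.

End Cofinite.

Theorem theorem2p7 (R : realType) (V : voa R[i]) :
  [<-> C2_cofinite V;
       forall M : weak_module V,
         direct_sum (gen_eigenspace (L_op M 0)) setT;
       forall M : weak_module V,
         exists2 W : nat -> set M, N_grading M W &
           forall n : nat,
             direct_sum (fun a : R[i] => gen_eigenspace (L_op M 0) a `&` W n)
                        (W n);
       finitely_generated V /\
         forall M : weak_module V, exists W : nat -> set M, N_grading M W].
Proof.
have cofin_eigen := @eigen_direct_sum_of_C2_cofinite R[i] V.
have cofin_grade := @N_graded_of_C2_cofinite R[i] V.
tfae.
- by move=> cof M; apply: cofin_eigen.
- move=> eig; have cof : C2_cofinite V by exact: C2_cofinite_of_eigen (eig _).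
  by move=> M; apply: cofin_grade.
- move=> gr; have {}gr (M : weak_module V) : exists W : nat -> set M, N_grading M W.
    by have [W gW _] := gr M; exists W.
  split=> //; apply: finitely_generated_of_C2_cofinite.
  exact: C2_cofinite_of_N_graded (gr _).
- by move=> [_ gr]; exact: C2_cofinite_of_N_graded (gr _).
Qed.
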